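(* Let $A$ be a unital operator algebra containing a $C^*$-subalgebra $D$ unitally (with common identity). For $D$-characters $\Phi,\Psi$ of $A$, the following conditions are equivalent: (1) $\|\Phi-\Psi\|<2$; (2) $\|\Phi|_{\mathrm{Ker}\,\Psi}\|<1$; (3) there is a constant $M>0$ with $\rho(\Phi(a),\Psi(a))\le M$ for all $a\in A$ with $\|a\|<1$; (4) whenever $(a_n)$ is a sequence in $\mathrm{Ball}(A)$ with $\|\Phi(a_n)\|\to1$, then $\|\Psi(a_n)\|\to1$. The relation on the set of $D$-characters of $A$ defined by these equivalent conditions is an equivalence relation.
   Context: A unital operator algebra is a norm-closed subalgebra $A$ of a unital $C^*$-algebra containing its identity. A $D$-character of $A$ is a contractive unital homomorphism $A\to D$ which restricts to the identity map on $D$. $\mathrm{Ball}(A)$ is the closed unit ball of $A$. For elements $x,y$ of norm $<1$ of a unital $C^*$-algebra, $$\rho(x,y)=\tanh^{-1}\left\|(1-xx^* )^{-1/2}(x-y)(1-x^*y)^{-1}(1-x^*x)^{1/2}\right\|.$$ *)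

(* Defs.v *)
From HB Require Import structures.
From mathcomp Require Import all_boot all_order all_algebra.
From mathcomp Require Import complex.
From mathcomp Require Import all_classical all_reals all_analysis.

Set Implicit Arguments.
Unset Strict Implicit.
Unset Printing Implicit Defensive.

Import Order.TTheory GRing.Theory Num.Theory.
Import numFieldNormedType.Exports.

Local Open Scope classical_set_scope.
Local Open Scope ring_scope.
Local Open Scope complex_scope.

(* Unital C*-algebras over R[i], with 1 != 0 as for every algebra of MathComp.
   This is a record, not a Hierarchy Builder structure: the latter would need a
   join of the normed modules with the rings, which cannot be declared after
   numDomainType, since numDomainType already inherits from both. *)
Record cstarAlgType (R : realType) := CStarAlg {
  cstar_base : completeNormedModType R[i];
  cstar_one : cstar_base;
  cstar_mul : cstar_base -> cstar_base -> cstar_base;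
  cstar_star : cstar_base -> cstar_base;
  cstar_mulA : associative cstar_mul;
  cstar_mul1r : left_id cstar_one cstar_mul;
  cstar_mulr1 : right_id cstar_one cstar_mul;
  cstar_mulDl : left_distributive cstar_mul +%R;
  cstar_mulDr : right_distributive cstar_mul +%R;
  cstar_oner_neq0 : cstar_one != 0;
  cstar_scaleAl : forall (l : R[i]) x y,
    l *: cstar_mul x y = cstar_mul (l *: x) y;
  cstar_scaleAr : forall (l : R[i]) x y,
    l *: cstar_mul x y = cstar_mul x (l *: y);
  cstar_normM : forall x y, `|cstar_mul x y| <= `|x| * `|y|;
  cstar_starD : forall x y, cstar_star (x + y) = cstar_star x + cstar_star y;
  cstar_starZ : forall (l : R[i]) x,
    cstar_star (l *: x) = conjc l *: cstar_star x;
  cstar_starM : forall x y,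
    cstar_star (cstar_mul x y) = cstar_mul (cstar_star y) (cstar_star x);
  cstar_starK : involutive cstar_star;
  cstar_norm_starM : forall x, `|cstar_mul (cstar_star x) x| = `|x| ^+ 2
}.

Definition cstar_sort (R : realType) (B : cstarAlgType R) : Type :=
  cstar_base B.
Coercion cstar_sort : cstarAlgType >-> Sortclass.

Section CStarAlgebraStructures.
Variables (R : realType) (B : cstarAlgType R).

HB.instance Definition _ := CompleteNormedModule.copy B (cstar_base B).
HB.instance Definition _ := GRing.Zmodule_isNzRing.Build B
  (@cstar_mulA R B) (@cstar_mul1r R B) (@cstar_mulr1 R B)
  (@cstar_mulDl R B) (@cstar_mulDr R B) (@cstar_oner_neq0 R B).
HB.instance Definition _ :=
  GRing.Lmodule_isLalgebra.Build R[i] B (@cstar_scaleAl R B).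
HB.instance Definition _ :=
  GRing.Lalgebra_isAlgebra.Build R[i] B (@cstar_scaleAr R B).

Let inverses (x : B) : set B := [set y | y * x = 1 /\ x * y = 1].
Let unit : pred B := fun x => `[< inverses x !=set0 >].
Let inv (x : B) : B := xget x (inverses x).

Let invP x : x \in unit -> inverses x (inv x).
Proof. by move/asboolP => [y xy]; exact: (xgetPex x (ex_intro _ y xy)). Qed.

Let mulVx : {in unit, left_inverse 1 inv *%R}.
Proof. by move=> x /invP[]. Qed.

Let mulxV : {in unit, right_inverse 1 inv *%R}.
Proof. by move=> x /invP[]. Qed.

Let unitP (x y : B) : y * x = 1 /\ x * y = 1 -> unit x.
Proof. by move=> yx; apply/asboolP; exists y. Qed.

Let inv_out : {in [predC unit], inv =1 id}.
Proof.
move=> x /negP Ux; rewrite /inv; case: xgetP => // y _ xy.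
by case: Ux; apply: unitP xy.
Qed.

HB.instance Definition _ :=
  GRing.NzRing_hasMulInverse.Build B mulVx mulxV unitP inv_out.

End CStarAlgebraStructures.

Section CStarAlgebraDefs.
Variables (R : realType) (B : cstarAlgType R).
Implicit Types x y : B.

Definition star x : B := cstar_star x.

(* The norm of the library takes its values in the nonnegative part of R[i]. *)
Definition nrm x : R := complex.Re `|x|.

Definition spectrum x : set R[i] := [set l | x - l%:A \isn't a GRing.unit].

(* 0 <= l in R[i] means that l is real and nonnegative. *)
Definition cstar_positive x : Prop :=
  star x = x /\ forall l, spectrum x l -> 0 <= l.

Definition csqrt x : B := xget 0 [set s | cstar_positive s /\ s ^+ 2 = x].

(* Inverse hyperbolic tangent, meaningful for |t| < 1. *)
Definition atanh (t : R) : R := ln ((1 + t) / (1 - t)) / 2.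

(* Meaningful for x and y of norm < 1. *)
Definition rho x y : R :=
  atanh (nrm ((csqrt (1 - x * star x))^-1 * (x - y) * (1 - star x * y)^-1
              * csqrt (1 - star x * x))).

End CStarAlgebraDefs.

Record operatorAlgebra (R : realType) (B : cstarAlgType R) := OperatorAlgebra {
  opalg_pred :> {pred B};
  opalg_subalg : subalg_closed opalg_pred;
  opalg_closed : closed [set x | x \in opalg_pred]
}.

Section OperatorAlgebraElt.
Variables (R : realType) (B : cstarAlgType R) (A : operatorAlgebra B).

HB.instance Definition _ := GRing.isSubalgClosed.Build R[i] B (opalg_pred A)
  (opalg_subalg A).

Record opalg_elt := OpalgElt {
  opalg_val :> B;
  opalg_valP : opalg_val \in opalg_pred A
}.

HB.instance Definition _ := [isSub for opalg_val].
HB.instance Definition _ := [Choice of opalg_elt by <:].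
HB.instance Definition _ := [SubChoice_isSubAlgebra of opalg_elt by <:].

End OperatorAlgebraElt.

Section DCharacters.
Variables (R : realType) (B : cstarAlgType R) (A D : operatorAlgebra B).

Record dcharacter := DCharacter {
  dchar_map :> {lrmorphism opalg_elt A -> opalg_elt D};
  dchar_contractive : forall a : opalg_elt A, nrm (dchar_map a) <= nrm a;
  dchar_id : forall (a : opalg_elt A) (d : opalg_elt D),
    a = d :> B -> dchar_map a = d
}.

Definition opnorm_on (S : set (opalg_elt A)) (f : opalg_elt A -> opalg_elt D) :
    \bar R :=
  ereal_sup [set (nrm (f a))%:E | a in [set a | S a /\ nrm a <= 1]].

Definition dchar_ker (Psi : dcharacter) : set (opalg_elt A) :=
  [set a | Psi a = 0].

End DCharacters.

(* Main.v *)
(* Write d^* for star d. A D-character f fixes D, so it commutes with the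
   operator Moebius maps
     a |-> (1 - d d^* )^(-1/2) (d - a) (1 - d^* a)^-1 (1 - d^* d)^(1/2), d in D;
   these preserve the unit ball of A and, for d = f(a), send a into Ker f. Hence
   bounding rho(f(a), g(a)) amounts to bounding g on Ker f.
   Norm distance < 2 is handled by scalar Moebius maps: if |f(x)| is close to 1,
   replace x by x d^* d d^* with d = f(x), so that f(x) becomes the square of a
   self-adjoint element, whose norm lies in its spectrum. If |g(x)| stays away
   from 1, then z |-> (r-z)/(1-rz) with r close to 1 moves g(x) close to 1 and
   that spectral value close to -1, so f - g has norm close to 2.
   The C^*-algebra facts are obtained without functional calculus, from two fixed
   points: y = 1 + xy for inverses and w = (x + w^2)/2 for 1 - w = (1-x)^(1/2). *)

Require Import Defs.
From HB Require Import structures.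
From mathcomp Require Import all_boot all_order all_algebra.
From mathcomp Require Import complex ring lra.
From mathcomp Require Import all_classical all_reals all_analysis.

Set Implicit Arguments.
Unset Strict Implicit.
Unset Printing Implicit Defensive.

Import Order.TTheory GRing.Theory Num.Theory.
Import numFieldNormedType.Exports.

Local Open Scope classical_set_scope.
Local Open Scope ring_scope.
Local Open Scope complex_scope.

(** * Real-valued norm, involution and the C*-identity *)

Section Norm.
Variables (R : realType) (B : cstarAlgType R).
Implicit Types (x y z : B) (r : R).

Lemma nrmE x : `|x| = (nrm x)%:C.
Proof. by rewrite /nrm RRe_real// normr_real. Qed.

Lemma nrm_ge0 x : 0 <= nrm x.
Proof. by rewrite -ler0c -nrmE. Qed.

Lemma nrm0 : nrm (0 : B) = 0.
Proof. by rewrite /nrm normr0. Qed.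

Lemma nrm_eq0 x : (nrm x == 0) = (x == 0).
Proof. by rewrite -[RHS]normr_eq0 nrmE -(inj_eq (@complexI R)). Qed.

Lemma nrmN x : nrm (- x) = nrm x.
Proof. by rewrite /nrm normrN. Qed.

Lemma nrmC x y : nrm (x - y) = nrm (y - x).
Proof. by rewrite -nrmN opprB. Qed.

Lemma nrmD x y : nrm (x + y) <= nrm x + nrm y.
Proof.
rewrite -lecR (_ : (nrm x + nrm y)%:C = `|x| + `|y|); last by rewrite !nrmE rmorphD.
by rewrite -nrmE; exact: ler_normD.
Qed.

Lemma nrmB x y : nrm (x - y) <= nrm x + nrm y.
Proof. by rewrite -[nrm y]nrmN nrmD. Qed.

Lemma nrmM x y : nrm (x * y) <= nrm x * nrm y.
Proof.
rewrite -lecR (_ : (nrm x * nrm y)%:C = `|x| * `|y|); last by rewrite !nrmE rmorphM.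
by rewrite -nrmE; exact: cstar_normM.
Qed.

Lemma nrmZ r x : nrm (r%:C *: x) = `|r| * nrm x.
Proof.
apply: (@complexI R); rewrite -nrmE normrZ rmorphM nrmE; congr (_ * _).
by rewrite normc_def /= expr0n /= addr0 sqrtr_sqr.
Qed.

Lemma nrm_starM x : nrm (star x * x) = nrm x ^+ 2.
Proof.
apply: (@complexI R); rewrite (_ : (nrm x ^+ 2)%:C = `|x| ^+ 2).
  by rewrite -nrmE; exact: cstar_norm_starM.
by rewrite nrmE rmorphXn.
Qed.

Lemma starD x y : star (x + y) = star x + star y.
Proof. exact: cstar_starD. Qed.

Lemma star0 : star (0 : B) = 0.
Proof. by apply: (addrI (star 0)); rewrite -starD !addr0. Qed.

Lemma starN x : star (- x) = - star x.
Proof. by apply: (addrI (star x)); rewrite -starD !subrr star0. Qed.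

Lemma starB x y : star (x - y) = star x - star y.
Proof. by rewrite starD starN. Qed.

Lemma starM x y : star (x * y) = star y * star x.
Proof. exact: cstar_starM. Qed.

Lemma starK x : star (star x) = x.
Proof. exact: cstar_starK. Qed.

Lemma starZ (l : R[i]) x : star (l *: x) = conjc l *: star x.
Proof. exact: cstar_starZ. Qed.

Lemma starZr r x : star (r%:C *: x) = r%:C *: star x.
Proof. by rewrite starZ conjc_real. Qed.

Lemma star1 : star (1 : B) = 1.
Proof. by rewrite -[LHS]mul1r -[X in X * _]starK -starM mul1r starK. Qed.

Lemma nrm1 : nrm (1 : B) = 1.
Proof.
have := nrm_starM 1; rewrite star1 mul1r expr2 => h.
by apply: (@mulfI _ (nrm (1 : B))); rewrite ?mulr1 -?h// nrm_eq0 oner_neq0.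
Qed.

Lemma nrm_star x : nrm (star x) = nrm x.
Proof.
have le y : nrm y <= nrm (star y).
  have [->|y0] := eqVneq y 0; first by rewrite star0.
  rewrite -(@ler_pM2r _ (nrm y)) ?lt_def ?nrm_eq0 ?y0 ?nrm_ge0//.
  by rewrite -expr2 -nrm_starM nrmM.
by apply/eqP; rewrite eq_le le -{2}[x]starK le.
Qed.

Lemma nrm_sa x : star x = x -> nrm (x * x) = nrm x ^+ 2.
Proof. by move=> sx; rewrite -{1}sx nrm_starM. Qed.

Lemma nrm_scalar r : nrm ((r%:C)%:A : B) = `|r|.
Proof. by rewrite nrmZ nrm1 mulr1. Qed.

End Norm.

(** * Closed sets, fixed points, inverses and square roots *)

Section FixedPoint.
Variables (R : realType) (B : cstarAlgType R).
Implicit Types (x y z : B) (r : R).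

(** The radii of the topology on [B] are positive elements of [R[i]]; such elements are real, so
    real [e] suffice. *)
Lemma cvg_nrmP (u : B ^nat) (l : B) :
  u @ \oo --> l <-> forall e : R, 0 < e -> \forall n \near \oo, nrm (l - u n) < e.
Proof.
split=> [/cvgrPdist_lt ul e e0|ul].
  have := ul e%:C; rewrite ltcR => /(_ e0); apply: filterS => n.
  by rewrite nrmE ltcR.
apply/cvgrPdist_lt => e e0.
have e1 : e = (complex.Re e)%:C by rewrite RRe_real// gtr0_real.
move: e0; rewrite e1 ltcR => /ul; apply: filterS => n.
by rewrite nrmE ltcR.
Qed.

Lemma lipschitz_continuous (f : B -> B) (k : R) :
  (forall x y, nrm (f x - f y) <= k * nrm (x - y)) -> continuous f.
Proof.
move=> fk x; apply/cvgrPdist_lt => e e0.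
have e1 : e = (complex.Re e)%:C by rewrite RRe_real// gtr0_real.
move: e0; rewrite e1 ltcR; set d := complex.Re e => d0.
have k0 : 0 < `|k| + 1 by rewrite ltr_wpDl.
near=> y; rewrite nrmE ltcR (le_lt_trans (fk _ _))//.
apply: (@le_lt_trans _ _ ((`|k| + 1) * nrm (x - y))).
  by rewrite ler_wpM2r ?nrm_ge0// (le_trans (ler_norm _))// lerDl.
rewrite -ltr_pdivlMl// -ltcR -nrmE; near: y.
by apply: cvgr_dist_lt; [exact: cvg_id|rewrite ltcR mulr_gt0 ?invr_gt0].
Unshelve. all: by end_near. Qed.

Lemma closed_lipschitz_eq0 (f : B -> B) (k : R) :
  (forall x y, nrm (f x - f y) <= k * nrm (x - y)) ->
  closed [set x | f x = 0].
Proof.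
move=> /lipschitz_continuous cf.
rewrite (_ : [set x | f x = 0] = f @^-1` [set 0])//.
apply: preimage_closed => //.
exact/accessible_closed_set1/hausdorff_accessible/norm_hausdorff.
Qed.
End FixedPoint.

(* Normalisation of noncommutative ring expressions *)
From Stdlib Require Ncring Ncring_tac.
#[export] Instance noncomm_ring_ops (R : nzRingType) :
  @Ncring.Ring_ops R 0 1 (@GRing.add R) (@GRing.mul R) (fun x y => x - y)
    (@GRing.opp R) (@eq R) := {}.

#[export] Instance noncomm_ring (R : nzRingType) :
  @Ncring.Ring R 0 1 (@GRing.add R) (@GRing.mul R) (fun x y => x - y)
    (@GRing.opp R) (@eq R) (noncomm_ring_ops R).
Proof.
split; try (by move=> ? ? -> ? ? ->); try (by move=> ? ? ->).
- exact: RelationClasses.eq_equivalence.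
- exact: add0r.
- exact: addrC.
- exact: addrA.
- exact: mul1r.
- exact: mulr1.
- exact: mulrA.
- by move=> *; exact: mulrDl.
- by move=> *; exact: mulrDr.
- by [].
- exact: subrr.
Qed.

Ltac ncring := Ncring_tac.non_commutative_ring.

Section FixedPointTheorem.
Variables (R : realType) (B : cstarAlgType R).
Implicit Types (x y z : B) (r : R) (C : set B).

(** Banach's contraction principle inside a closed stable set. The freedom in [C] is what later
    transfers self-adjointness, commutation and membership in a closed subalgebra to fixed
    points. *)
Lemma closed_fixpoint C (f : B -> B) (q : R) x0 :
  closed C -> C x0 -> (forall x, C x -> C (f x)) -> 0 <= q < 1 ->
  (forall x y, C x -> C y -> nrm (f x - f y) <= q * nrm (x - y)) ->
  exists2 x, C x & f x = x.
Proof.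
move=> clC C0 Cf /andP[q0 q1] fq.
pose u n : B := iter n f x0; pose d := nrm (f x0 - x0) / (1 - q).
have q1' : 0 < 1 - q by rewrite subr_gt0.
have Cu n : C (u n) by elim: n => //= n; exact: Cf.
have d0 : 0 <= d by rewrite divr_ge0 ?nrm_ge0 ?ltW.
have u1 n : nrm (u n.+1 - u n) <= q ^+ n * nrm (f x0 - x0).
  elim: n => [|n ih]; first by rewrite expr0 mul1r.
  rewrite (le_trans (fq _ _ (Cu n.+1) (Cu n)))// exprS -mulrA.
  by rewrite ler_wpM2l.
have um n m : nrm (u (n + m)%N - u n) <= d * (q ^+ n - q ^+ (n + m)).
  elim: m => [|m ih]; first by rewrite addn0 !subrr nrm0 mulr0.
  have -> : u (n + m.+1)%N - u n = (u (n + m).+1 - u (n + m)%N) + (u (n + m)%N - u n).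
    by rewrite addnS addrA subrK.
  rewrite (le_trans (nrmD _ _))// (le_trans (lerD (u1 _) ih))//.
  rewrite addnS exprS [nrm _](_ : _ = d * (1 - q)); first by lra.
  by rewrite /d divfK// gt_eqF.
have qcv e : 0 < e -> \forall n \near \oo, d * q ^+ n < e.
  move=> e0; have d1 : 0 < d + 1 by rewrite ltr_wpDl.
  near=> n.
  apply: (@le_lt_trans _ _ ((d + 1) * q ^+ n)).
    by rewrite ler_wpM2r ?exprn_ge0// lerDl.
  rewrite -ltr_pdivlMl// -[q ^+ n]ger0_norm ?exprn_ge0//.
  near: n.
  have := @cvg_expr R q; rewrite ger0_norm// => /(_ q1)/cvgr0_norm_lt; apply.
  by rewrite mulr_gt0 ?invr_gt0.
have : cvg (u @ \oo).
  apply: cauchy_cvg; apply: cauchy_exP => e e0.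
  have e1 : e = (complex.Re e)%:C by rewrite RRe_real// gtr0_real.
  move: e0; rewrite e1 ltcR => /qcv [N _ /(_ N (leqnn N))/= hN].
  exists (u N); exists N => // n /= Nn.
  rewrite -ball_normE /= nrmE ltcR nrmC -(subnKC Nn).
  rewrite (le_lt_trans (um _ _))// (le_lt_trans _ hN)// ler_wpM2l//.
  by rewrite gerBl exprn_ge0.
move=> /cvg_ex[l ul].
have Cl : C l by apply: closed_cvg ul => //; exact: nearW.
exists l => //; apply/eqP; rewrite -subr_eq0 -nrm_eq0 eq_le nrm_ge0 andbT.
apply/ler_addgt0Pr => e e0; rewrite add0r.
have /cvg_nrmP/(_ (e / 2)) := ul; rewrite divr_gt0// => /(_ isT)[N _ hN].
have := hN N (leqnn N); have := hN N.+1 (leqnSn N) => /= h1 h2.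
have -> : f l - l = (f l - f (u N)) - (l - u N.+1) by rewrite /u /= opprB addrA subrK.
rewrite (le_trans (nrmB _ _))// (splitr e) lerD//; last exact: ltW.
rewrite (le_trans (fq _ _ _ _))// (le_trans _ (ltW h2))//.
by rewrite ler_piMl ?nrm_ge0// ltW.
Unshelve. all: by end_near. Qed.

Lemma nrm_continuous : continuous (@nrm R B).
Proof.
move=> x; apply/cvgrPdist_lt => e e0; near=> y.
apply: (@le_lt_trans _ _ (nrm (x - y))).
  rewrite ler_norml; apply/andP; split.
    by have := nrmD x (y - x); rewrite addrC subrK nrmC; lra.
  by have := nrmD y (x - y); rewrite addrC subrK; lra.
rewrite -ltcR -nrmE; near: y.
by apply: cvgr_dist_lt; [exact: cvg_id|rewrite ltcR].
Unshelve. all: by end_near. Qed.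

Lemma closed_nrm_le (c : R) : closed [set x : B | nrm x <= c].
Proof.
rewrite (_ : [set x | _] = @nrm R B @^-1` [set t | t <= c])//.
by apply: preimage_closed => [x _|]; [exact: nrm_continuous|exact: closed_le].
Qed.

(** The inverse is the fixed point of [v |-> 1 + x * v], a contraction of ratio [nrm x]. The last
    clause places it in every closed set that contains 0 and is stable under this map. *)
Lemma neumann x : nrm x < 1 -> exists y, [/\ y * (1 - x) = 1, (1 - x) * y = 1 &
  forall C, closed C -> C 0 -> (forall v, C v -> C (1 + x * v)) -> C y].
Proof.
move=> x1.
have fix_in C : closed C -> C 0 -> (forall v, C v -> C (1 + x * v)) ->
    exists2 y, C y & 1 + x * y = y.
  move=> clC C0 CC; apply: (@closed_fixpoint C _ (nrm x) 0) => // [|u v _ _].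
    by rewrite nrm_ge0.
  by rewrite opprD addrACA subrr add0r -mulrBr nrmM.
have right y : 1 + x * y = y -> (1 - x) * y = 1.
  by move=> yE; rewrite mulrBl mul1r -{1}yE addrK.
(* A fixed point is only a right inverse of [1 - x]; finding it in the commutant of [x] makes it a
   left inverse too. *)
have clcomm : closed [set y | x * y - y * x = 0].
  apply: (@closed_lipschitz_eq0 _ _ _ (2 * nrm x)) => u v.
  have -> : x * u - u * x - (x * v - v * x) = x * (u - v) - (u - v) * x.
    by ncring.
  rewrite (le_trans (nrmB _ _))//.
  have := nrmM x (u - v); have := nrmM (u - v) x; lra.
have [|v /subr0_eq vE|y /subr0_eq xy yE] := fix_in _ clcomm.
- by rewrite /= mulr0 mul0r subrr.
- by rewrite /= mulrDr mulrDl mulr1 mul1r -mulrA -vE subrr.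
have yx : y * (1 - x) = 1 by rewrite mulrBr mulr1 -xy -[X in X - _]yE addrK.
exists y; split => //; first exact: right.
move=> C clC C0 CC; have [z Cz /right zE] := fix_in C clC C0 CC.
suff -> : y = z by [].
by rewrite -[y]mulr1 -zE mulrA yx mul1r.
Qed.

(** The equation [(1 - w)^2 = 1 - x] says that [w] is fixed by [v |-> (x + v^2) / 2]. On the ball of
    radius [c] this map has ratio [c], and [(c + c^2) / 2 <= c] keeps it inside. *)
Lemma sqrt_1B x (c : R) : nrm x <= c -> c < 1 ->
  exists w, [/\ nrm w <= c, (1 - w) * (1 - w) = 1 - x &
    forall C, closed C -> C 0 ->
      (forall v, C v -> C (2^-1%:C *: (x + v * v))) -> C w].
Proof.
move=> xc c1; pose f v := 2^-1%:C *: (x + v * v).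
have c0 : 0 <= c by rewrite (le_trans (nrm_ge0 x)).
have lip u v : nrm u <= c -> nrm v <= c -> nrm (f u - f v) <= c * nrm (u - v).
  move=> uc vc; rewrite /f -scalerBr opprD addrACA subrr add0r nrmZ ger0_norm ?invr_ge0//.
  have -> : u * u - v * v = u * (u - v) + (u - v) * v.
    by rewrite mulrBr mulrBl addrA subrK.
  rewrite ler_pdivrMl// (le_trans (nrmD _ _))//.
  have := nrmM u (u - v); have := nrmM (u - v) v.
  have := ler_wpM2r (nrm_ge0 (u - v)) uc.
  by have := ler_wpM2r (nrm_ge0 (u - v)) vc; lra.
have fix_in C : closed C -> C 0 -> (forall v, C v -> C (f v)) ->
    exists2 w, C w & nrm w <= c /\ f w = w.
  move=> clC C0 CC.
  have [||v [Cv vc]|||w [Cw wc] wE] :=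
    @closed_fixpoint (C `&` [set v | nrm v <= c]) f c 0.
  - by apply: closedI => //; exact: closed_nrm_le.
  - by split => //=; rewrite nrm0.
  - split; first exact: CC.
    rewrite /= /f nrmZ ger0_norm ?invr_ge0// ler_pdivrMl//.
    rewrite (le_trans (nrmD _ _))//.
    have := nrmM v v; have := @ler_pM _ _ _ _ _ (nrm_ge0 v) (nrm_ge0 v) vc vc.
    by have : c * c <= c by [rewrite ler_piMl// ltW]; lra.
  - by rewrite c0.
  - by move=> u v [_ uc] [_ vc]; exact: lip.
  - by exists w.
have [//|//|w _ [wc wE]] := fix_in setT closedT.
exists w; split => //; last first.
  move=> C clC C0 CC; have [z Cz [zc zE]] := fix_in C clC C0 CC.
  suff -> : w = z by [].
  apply/subr0_eq/eqP; rewrite -nrm_eq0 eq_le nrm_ge0 andbT.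
  rewrite -(@pmulr_rle0 _ (1 - c)) ?subr_gt0//.
  by have := lip _ _ wc zc; rewrite wE zE; lra.
have : w + w = x + w * w.
  rewrite -[in LHS]wE /f -scalerDl -rmorphD /=.
  by rewrite (_ : 2^-1 + 2^-1 = 1 :> R) ?scale1r//; lra.
move=> ww; have -> : (1 - w) * (1 - w) = 1 - (w + w) + w * w by ncring.
by rewrite ww; ncring.
Qed.

End FixedPointTheorem.

(** * Positivity in C*-algebras *)

Section CStarTheory.
Variables (R : realType) (B : cstarAlgType R).
Implicit Types (x y z g k : B) (r : R).

Lemma half_double x : 2^-1%:C *: (x + x) = x.
Proof.
rewrite scalerDr -scalerDl -(rmorphD (real_complex R)) /=.
by rewrite (_ : 2^-1 + 2^-1 = 1 :> R) ?scale1r//; lra.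
Qed.

Lemma invr_unique x y : y * x = 1 -> x * y = 1 -> x^-1 = y.
Proof.
move=> yx xy; have ux : x \is a GRing.unit by apply/unitrP; exists y.
by rewrite -[y]mulr1 -(mulrV ux) mulrA yx mul1r.
Qed.

Lemma starV x : x \is a GRing.unit -> star x^-1 = (star x)^-1.
Proof.
by move=> ux; apply/esym/invr_unique; rewrite -starM ?mulVr ?mulrV// star1.
Qed.

Lemma star_unit x : x \is a GRing.unit -> star x \is a GRing.unit.
Proof.
by move=> ux; apply/unitrP; exists (star x^-1); rewrite -!starM mulVr ?mulrV// star1.
Qed.

Lemma closed_sa : closed [set x : B | star x = x].
Proof.
rewrite (_ : [set x | _] = [set x : B | star x - x = 0]).
  apply: (@closed_lipschitz_eq0 _ _ _ 2) => u v.
  have -> : star u - u - (star v - v) = star (u - v) - (u - v).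
    by rewrite starB; ncring.
  by rewrite (le_trans (nrmB _ _))// nrm_star; lra.
by apply/seteqP; split => x /= [/eqP]; rewrite ?subr_eq0;
  [move/eqP->; rewrite subrr|move/eqP].
Qed.

Lemma closed_comm g : closed [set x : B | g * x = x * g].
Proof.
rewrite (_ : [set x | _] = [set x : B | g * x - x * g = 0]).
  apply: (@closed_lipschitz_eq0 _ _ _ (2 * nrm g)) => u v.
  have -> : g * u - u * g - (g * v - v * g) = g * (u - v) - (u - v) * g by ncring.
  rewrite (le_trans (nrmB _ _))//.
  have := nrmM g (u - v); have := nrmM (u - v) g; lra.
by apply/seteqP; split => x /= [/eqP]; rewrite ?subr_eq0;
  [move/eqP->; rewrite subrr|move/eqP].
Qed.

Lemma unit_1B x : nrm x < 1 -> (1 - x) \is a GRing.unit.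
Proof. by move=> /neumann[y [yx xy _]]; apply/unitrP; exists y. Qed.

Lemma mem_inv_1B (A : operatorAlgebra B) x :
  x \in A -> nrm x < 1 -> (1 - x)^-1 \in A.
Proof.
move=> xA /neumann[y [yx xy CC]]; rewrite (invr_unique yx xy).
apply: (CC _ (@opalg_closed _ _ A)); first exact: rpred0.
by move=> v vA /=; rewrite rpredD ?rpred1// rpredM.
Qed.

Lemma nrm_inv_1B x : nrm x < 1 -> nrm (1 - x)^-1 <= (1 - nrm x)^-1.
Proof.
move=> x1; have u := unit_1B x1; have x1' : 0 < 1 - nrm x by rewrite subr_gt0.
rewrite -[leRHS]mul1r ler_pdivlMr//.
set y := (1 - x)^-1; have yE : y = 1 + x * y.
  by have := mulrV u; rewrite -/y mulrBl mul1r => /(canRL (subrK _)).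
have := nrmD 1 (x * y); rewrite -yE nrm1; have := nrmM x y; lra.
Qed.

Lemma sa_sqrt_1B x (c : R) : star x = x -> nrm x <= c -> c < 1 ->
  exists s, [/\ star s = s, s * s = 1 - x, nrm (1 - s) <= c,
    forall g, g * x = x * g -> g * s = s * g &
    forall A : operatorAlgebra B, x \in A -> s \in A].
Proof.
move=> sx xc c1; have [w [wc ww CC]] := sqrt_1B xc c1.
have sw : star w = w.
  apply: (CC _ closed_sa); first exact: star0.
  by move=> v /= vE; rewrite starZr starD starM sx vE.
exists (1 - w); split.
- by rewrite starB star1 sw.
- by [].
- by rewrite opprB addrC subrK.
- move=> g gx; rewrite mulrBr mulrBl mulr1 mul1r; congr (_ - _).
  apply: (CC _ (@closed_comm g)); first by rewrite /= mulr0 mul0r.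
  move=> v /= gv; rewrite -scalerAr -scalerAl; congr (_ *: _).
  by rewrite mulrDr mulrDl gx mulrA gv -mulrA gv mulrA.
- move=> A xA; rewrite rpredB ?rpred1//.
  apply: (CC _ (@opalg_closed _ _ A)); first exact: rpred0.
  by move=> v vA /=; rewrite rpredZ// rpredD// rpredM.
Qed.

(* z = g + i k satisfies star z * z = c, and g = (z + star z) / 2. *)
Lemma nrm_sqr_le g k (c : R) : star g = g -> star k = k -> g * k = k * g ->
  0 <= c -> g * g + k * k = c%:C%:A -> nrm g ^+ 2 <= c.
Proof.
move=> sg sk gk c0 gkc; pose z := g + 'i%C *: k.
have sz : star z = g - 'i%C *: k.
  rewrite /z starD starZ sg sk -scaleNr; congr (_ + _ *: _).
  by apply/eqP; rewrite eq_complex /= oppr0 !eqxx.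
have zz : star z * z = c%:C%:A.
  rewrite -gkc sz /z mulrDr !mulrBl -!scalerAr -!scalerAl gk scalerA.
  by rewrite (_ : 'i%C * 'i%C = -1 :> R[i]) ?scaleN1r; [ncring|rewrite -expr2 sqr_i].
have {zz} : nrm z ^+ 2 = c by rewrite -nrm_starM zz nrm_scalar ger0_norm.
move=> <-; rewrite ler_sqr ?nnegrE ?nrm_ge0//.
have gE : g = 2^-1%:C *: (z + star z).
  by rewrite sz /z addrACA subrr addr0 half_double.
rewrite gE nrmZ ger0_norm ?invr_ge0//.
by have := nrmD z (star z); rewrite nrm_star; lra.
Qed.

(** With [s] a root of [1 - g * g], the sum [s * s + g * g] is 1, so [nrm_sqr_le] bounds [s], and
    [nrm (s * s) = nrm s ^+ 2]. *)
Lemma nrm_1B_sqr g : star g = g -> nrm g < 1 -> nrm (1 - g * g) <= 1.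
Proof.
move=> sg g1.
have gg1 : nrm (g * g) < 1 by rewrite nrm_sa// expr_lt1// ?nrm_ge0.
have [||s [ss sE _ scomm _]] := @sa_sqrt_1B (g * g) (nrm (g * g)) _ _ gg1 => //.
  by rewrite starM sg.
rewrite -sE nrm_sa//; apply: (@nrm_sqr_le s g) => //.
  by apply/esym/scomm; rewrite mulrA.
by rewrite sE subrK scale1r.
Qed.

(* For self-adjoint x this says that x >= 0. *)
Definition cone x := exists k : R, nrm (k%:C%:A - x) <= k.

(** Centres and radii add. This is the reason for expressing positivity by norms: sums are hard to
    control through the spectrum alone. *)
Lemma coneD x y : cone x -> cone y -> cone (x + y).
Proof.
move=> [k kx] [l ly]; exists (k + l); rewrite rmorphD scalerDl.
have -> : k%:C%:A + l%:C%:A - (x + y) = (k%:C%:A - x) + (l%:C%:A - y) by ncring.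
by rewrite (le_trans (nrmD _ _))// lerD.
Qed.

Lemma coneZ (a : R) x : 0 <= a -> cone x -> cone (a%:C *: x).
Proof.
move=> a0 [k kx]; exists (a * k); rewrite rmorphM -scalerA -scalerBr nrmZ ger0_norm//.
by rewrite ler_wpM2l.
Qed.

Lemma cone_sqr g : star g = g -> cone (g * g).
Proof.
move=> sg; pose k := nrm g + 1.
have k0 : 0 < k by rewrite ltr_wpDl ?nrm_ge0.
exists (k * k).
have : nrm (1 - (k^-1%:C *: g) * (k^-1%:C *: g)) <= 1.
  apply: nrm_1B_sqr; first by rewrite starZr sg.
  by rewrite nrmZ ger0_norm ?invr_ge0 ?ltW// ltr_pdivrMl// mulr1 ltrDl.
rewrite -scalerAl -scalerAr scalerA => h.
rewrite (_ : _ - _ = (k * k)%:C *: (1 - (k^-1%:C * k^-1%:C) *: (g * g))).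
  by rewrite nrmZ ger0_norm ?mulr_ge0 ?(ltW k0)// -[leRHS]mulr1 ler_wpM2l// mulr_ge0// ltW.
rewrite scalerBr scalerA -!rmorphM /= (_ : k * k * _ = 1) ?scale1r//.
by rewrite mulrACA !divff ?mulr1// gt_eqF.
Qed.

Lemma unit_scale (a : R) x : a != 0 ->
  ((a%:C *: x) \is a GRing.unit) = (x \is a GRing.unit).
Proof.
by move=> a0; rewrite scaler_unit// unitfE -(rmorph0 (real_complex R)) (inj_eq (@complexI R)).
Qed.

Lemma unit_scalarB (a : R) x : nrm x < a -> (a%:C%:A - x) \is a GRing.unit.
Proof.
move=> xa; have a0 : 0 < a by rewrite (le_lt_trans (nrm_ge0 _) xa).
rewrite -(@unit_scale a^-1) ?invr_eq0 ?gt_eqF// scalerBr scalerA -rmorphM mulVf ?gt_eqF//.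
rewrite scale1r; apply: unit_1B.
by rewrite nrmZ ger0_norm ?invr_ge0 ?ltW// ltr_pdivrMl// mulr1.
Qed.

Lemma unit_scalarD (a : R) x : nrm x < a -> (a%:C%:A + x) \is a GRing.unit.
Proof. by move=> xa; rewrite -[x]opprK unit_scalarB// nrmN. Qed.

Lemma cone_unit (a : R) x : 0 < a -> cone x -> (a%:C%:A + x) \is a GRing.unit.
Proof.
move=> a0 [k kx].
have -> : a%:C%:A + x = (a + k)%:C%:A - (k%:C%:A - x) :> B.
  by rewrite rmorphD scalerDl; ncring.
by rewrite unit_scalarB// (le_lt_trans kx)// ltrDr.
Qed.

(* 1 - g^2 - d = (1 - g^2)(1 - d (1 - g^2)^-1) is the square of a self-adjoint k
   commuting with g, so g^2 + k^2 = 1 - d. *)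
Lemma nrm_sqr_le_of_inv g (d : R) : star g = g -> nrm g < 1 -> 0 < d ->
  d * nrm (1 - g * g)^-1 < 1 -> nrm g ^+ 2 <= 1 - d.
Proof.
move=> sg g1 d0; set q := _^-1 => dq.
have gg1 : nrm (g * g) < 1 by rewrite nrm_sa// expr_lt1// ?nrm_ge0.
have uh := unit_1B gg1.
have sgg : star (g * g) = g * g by rewrite starM sg.
have [//|//|r [sr rE _ rcomm _]] := @sa_sqrt_1B (g * g) (nrm (g * g)) _ _ gg1.
have gr : g * r = r * g by apply: rcomm; rewrite mulrA.
have sq : star q = q by rewrite starV// starB star1 sgg.
have qcomm x : x * (g * g) = (g * g) * x -> x * q = q * x.
  move=> xg; rewrite /q; apply: (@can_inj _ _ _ _ (mulKr uh)).
  by rewrite mulVKr// mulrA (_ : _ * x = x * (1 - g * g)) ?mulrK//;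
    rewrite mulrBl mulrBr xg mul1r mulr1.
have d1 : nrm (d%:C *: q) < 1 by rewrite nrmZ gtr0_norm.
have [|//|v [sv vE _ vcomm _]] := @sa_sqrt_1B (d%:C *: q) (nrm (d%:C *: q)) _ _ d1.
  by rewrite starZr sq.
have vc x : x * (g * g) = (g * g) * x -> x * v = v * x.
  by move=> xg; apply: vcomm; rewrite -scalerAr -scalerAl qcomm.
have gv : g * v = v * g by apply: vc; rewrite mulrA.
have rv : r * v = v * r.
  by apply: vc; rewrite !mulrA -gr -mulrA -gr mulrA.
apply: (@nrm_sqr_le g (r * v)) => //.
- by rewrite starM sr sv rv.
- by rewrite mulrA gr -mulrA gv mulrA.
(* [1 <= nrm (1 - g * g) * nrm q <= nrm q] forces [d <= d * nrm q < 1]. *)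
- rewrite subr_ge0 (le_trans _ (ltW dq))// ler_peMr ?(ltW d0)//.
  have := nrmM (1 - g * g) q; rewrite mulrV// nrm1 => /le_trans.
  by apply; rewrite ler_piMl ?nrm_ge0 ?nrm_1B_sqr.
have -> : r * v * (r * v) = (r * r) * (v * v).
  by rewrite -mulrA (mulrA v) -rv -!mulrA.
rewrite rE vE mulrBr mulr1 -scalerAr mulrV// addrA subrKC.
by rewrite rmorphB scalerBl scale1r.
Qed.

(** If the inverse [q] existed, with norm [K], shrinking [g] to [m g] with [m^2 = 1 - e] would
    multiply [1 - g * g] by a factor [1 - y] near 1, so the inverse would have norm at most [2 K].
    Then [nrm_sqr_le_of_inv] with [d = 1 / (4 K)] gives [m^2 <= 1 - d], against [e = d / 2]. *)
Lemma nrm1_sqr_not_unit g : star g = g -> nrm g = 1 ->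
  (1 - g * g) \isn't a GRing.unit.
Proof.
move=> sg g1; apply/negP => ug; set q := (1 - g * g)^-1.
pose K := nrm q; have K2 : 1 <= 2 * K.
  have := nrmM (1 - g * g) q; rewrite mulrV// nrm1 => /le_trans; apply; rewrite ler_wpM2r ?nrm_ge0//.
  by have := nrmB 1 (g * g); rewrite nrm1 nrm_sa// g1 expr1n.
have K0 : 0 < K by lra.
pose d := (4 * K)^-1; have d0 : 0 < d by rewrite invr_gt0 mulr_gt0.
have dK : d * K = 4^-1 by rewrite /d invfM -mulrA mulVf ?mulr1// gt_eqF.
pose e := d / 2; have e0 : 0 < e by rewrite /e; lra.
have e1 : e < 1.
  by rewrite /e; have : d <= d * (2 * K) by [rewrite ler_peMr// ltW]; lra.
pose m := Num.sqrt (1 - e).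
have mm : m * m = 1 - e by rewrite -expr2 sqr_sqrtr// subr_ge0 ltW.
have m0 : 0 <= m by exact: sqrtr_ge0.
have m1 : m < 1 by rewrite -(@ltr_pXn2r _ 2%N) ?nnegrE// expr2 mm expr1n; lra.
pose y := - (e%:C *: (g * g * q)).
have yK : nrm y <= 8^-1.
  rewrite nrmN nrmZ gtr0_norm// (@le_trans _ _ (e * K))//.
    rewrite ler_wpM2l ?(ltW e0)// (le_trans (nrmM _ _))// nrm_sa// g1 expr1n mul1r.
    by rewrite lexx.
  by rewrite /e mulrAC dK; lra.
have gE : 1 - (m%:C *: g) * (m%:C *: g) = (1 - y) * (1 - g * g).
  rewrite -scalerAl -scalerAr scalerA -rmorphM mm rmorphB rmorph1 scalerBl scale1r.
  by rewrite mulrBl mul1r /y mulNr opprK -scalerAl -[g * g * q * _]mulrA mulVr// mulr1; ncring.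
have uy : (1 - y) \is a GRing.unit by apply: unit_1B; lra.
have qE : (1 - (m%:C *: g) * (m%:C *: g))^-1 = q * (1 - y)^-1 by rewrite gE invrM.
have qK : nrm (q * (1 - y)^-1) <= K * 2.
  rewrite (le_trans (nrmM _ _))// ler_wpM2l ?(ltW K0)//.
  have y1 : nrm y < 1 by lra.
  rewrite (le_trans (nrm_inv_1B y1))// -[leRHS]invrK lef_pV2 ?posrE ?invr_gt0//; lra.
have dq : d * nrm (1 - (m%:C *: g) * (m%:C *: g))^-1 < 1.
  by rewrite qE; have := ler_wpM2l (ltW d0) qK; rewrite mulrA dK; lra.
have smg : star (m%:C *: g) = m%:C *: g by rewrite starZr sg.
have nmg : nrm (m%:C *: g) = m by rewrite nrmZ ger0_norm// g1 mulr1.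
have := nrm_sqr_le_of_inv smg _ d0 dq.
by rewrite nmg (expr2 m) mm => /(_ m1); rewrite /e; lra.
Qed.
 
Lemma sqr_not_unit g : star g = g -> 0 < nrm g ->
  ((nrm g ^+ 2)%:C%:A - g * g) \isn't a GRing.unit.
Proof.
move=> sg g0; pose n := nrm g.
have -> : (n ^+ 2)%:C%:A - g * g = (n ^+ 2)%:C *: (1 - (n^-1%:C *: g) * (n^-1%:C *: g)).
  rewrite scalerBr -scalerAl -scalerAr !scalerA -!rmorphM (_ : n ^+ 2 / n / n = 1) ?scale1r//.
  by rewrite expr2 mulfK ?divff// gt_eqF.
rewrite unit_scale ?expf_eq0 ?gt_eqF//=.
apply: nrm1_sqr_not_unit; first by rewrite starZr sg.
by rewrite nrmZ ger0_norm ?invr_ge0 ?nrm_ge0// mulVf// gt_eqF.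
Qed.

(** For [n = nrm g], the product [(n - g) (n + g)] is [n^2 - g * g], which [sqr_not_unit] excludes
    from the units. Thus [n] or [-n] is in the spectrum of [g]. *)
Lemma sa_spectrum g : star g = g -> 0 < nrm g ->
  (nrm g)%:C%:A - g \is a GRing.unit -> (nrm g)%:C%:A + g \is a GRing.unit -> False.
Proof.
move=> sg g0 um up; have /negP := sqr_not_unit sg g0; apply.
suff -> : (nrm g ^+ 2)%:C%:A - g * g = ((nrm g)%:C%:A - g) * ((nrm g)%:C%:A + g).
  by rewrite unitrMl.
rewrite mulrDr !mulrBl mulr_algl mulr_algr mulr_algl scalerA -rmorphM -(expr2 (nrm g)).
by rewrite addrA subrK.
Qed.

(** Jacobson's formula: the inverse of [1 - y * x] is [1 + y * q * x], with [q] the inverse of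
    [1 - x * y]. *)
Lemma unit_1BM x y : 1 - x * y \is a GRing.unit -> 1 - y * x \is a GRing.unit.
Proof.
move=> u; set q := (1 - x * y)^-1.
have h1 : q - x * y * q = 1 by rewrite -(mulrV u) mulrBl mul1r.
have h2 : q - q * x * y = 1 by rewrite -(mulVr u) mulrBr mulr1 mulrA.
apply/unitrP; exists (1 + y * q * x); split.
  have -> : (1 + y * q * x) * (1 - y * x) = 1 - y * x + y * (q - q * x * y) * x by ncring.
  by rewrite h2 mulr1 subrK.
have -> : (1 - y * x) * (1 + y * q * x) = 1 - y * x + y * (q - x * y * q) * x by ncring.
by rewrite h1 mulr1 subrK.
Qed.

Lemma unit_scalarBM (a : R) x y : a != 0 -> a%:C%:A - x * y \is a GRing.unit ->
  a%:C%:A - y * x \is a GRing.unit.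
Proof.
move=> a0; have E z : a%:C%:A - z = a%:C *: (1 - a^-1%:C *: z).
  by rewrite scalerBr scalerA -rmorphM divff// scale1r.
rewrite !E !unit_scale// scalerAl => /unit_1BM.
by rewrite -scalerAr.
Qed.

(* With n = (2 + x^* x)^-1 and y = x n, one has y^* y = n - 2n^2 <= 1/8, since
   1 - 8 y^* y = (1 - 4n)^2; hence y y^* <= 1/8 as well. As y^* y + y y^* is a
   sum of squares, y^* y >= -1/8, so that 1 + y^* y = (1 - n)(1 + 2n) is
   invertible, and 1 + x^* x = (1 - n)(2 + x^* x). *)
Lemma unit_2D_1D x : 1 + 1 + star x * x \is a GRing.unit ->
  1 + star x * x \is a GRing.unit.
Proof.
set h := star x * x => u2; set n := (1 + 1 + h)^-1.
have sh : star h = h by rewrite starM starK.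
have sn : star n = n by rewrite starV// !starD star1 sh.
have n1 : (1 + 1 + h) * n = 1 by rewrite mulrV.
pose y := x * n; set Y := star y * y; set Z := y * star y.
have YE : Y = n - (n * n + n * n).
  rewrite (_ : Y = n * ((1 + 1 + h) * n) - (n * n + n * n)); first by rewrite n1 mulr1.
  rewrite (_ : Y = n * h * n); first by ncring.
  by rewrite /Y /y starM sn /h -!mulrA.
pose G := 1 - (n + n + n + n).
have sG : star G = G by rewrite /G starB star1 !starD sn.
have Y8 : (8 : R)%:C *: Y = 1 - G * G.
  by rewrite (rmorph_nat (real_complex R)) scaler_nat !mulrS mulr0n YE /G; ncring.
have uY mu : 8^-1 < mu -> mu%:C%:A - Y \is a GRing.unit.
  move=> mu8; rewrite -(@unit_scale 8)// scalerBr scalerA -rmorphM Y8.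
  have -> : (8 * mu)%:C%:A - (1 - G * G) = (8 * mu - 1)%:C%:A + G * G :> B.
    by rewrite rmorphB scalerBl rmorph1 scale1r; ncring.
  by apply: cone_unit; [lra|exact: cone_sqr].
have uZ mu : 8^-1 < mu -> mu%:C%:A - Z \is a GRing.unit.
  by move=> mu8; apply: unit_scalarBM (uY _ mu8); rewrite gt_eqF// (lt_trans _ mu8).
have sZ : star Z = Z by rewrite starM starK.
(* If [K + Z] had norm [N > K + 1/8], both [N - (K + Z)] and [N + (K + Z)] would be units, the first
   by [uZ] and the second because [nrm Z = K < N + K]; [sa_spectrum] forbids this. *)
have cZ : cone (8^-1%:C%:A - Z).
  pose K := nrm Z; exists (K + 8^-1).
  have -> : (K + 8^-1)%:C%:A - (8^-1%:C%:A - Z) = K%:C%:A + Z :> B.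
    by rewrite rmorphD scalerDl; ncring.
  rewrite leNgt; apply/negP; set N := nrm _ => KN.
  have K0 : 0 <= K by exact: nrm_ge0.
  have sKZ : star (K%:C%:A + Z) = K%:C%:A + Z by rewrite starD starZr star1 sZ.
  have N0 : 0 < N by lra.
  apply: (sa_spectrum sKZ N0).
    have -> : N%:C%:A - (K%:C%:A + Z) = (N - K)%:C%:A - Z :> B.
      by rewrite rmorphB scalerBl; ncring.
    by apply: uZ; lra.
  have -> : N%:C%:A + (K%:C%:A + Z) = (N + K)%:C%:A + Z :> B.
    by rewrite rmorphD scalerDl; ncring.
  by apply: unit_scalarD; rewrite -/K; lra.
have cYZ : cone (Y + Z).
  pose a := y + star y; pose b := 'i%C *: (y - star y).
  have sa : star a = a by rewrite starD starK addrC.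
  have sb : star b = b.
    rewrite starZ starB starK -opprB scalerN -scaleNr; congr (_ *: _).
    by apply/eqP; rewrite eq_complex /= oppr0 opprK !eqxx.
  have -> : Y + Z = 2^-1%:C *: (a * a + b * b).
    rewrite /b -scalerAl -scalerAr scalerA.
    rewrite (_ : 'i%C * 'i%C = -1 :> R[i]); last by rewrite -expr2 sqr_i.
    by rewrite scaleN1r -[LHS]half_double /a /Y /Z; congr (_ *: _); ncring.
  by apply: coneZ; [rewrite invr_ge0|apply: coneD; exact: cone_sqr].
have u1Y : 1 + Y \is a GRing.unit.
  have -> : 1 + Y = (7 / 8)%:C%:A + ((Y + Z) + (8^-1%:C%:A - Z)) :> B.
    have {1}-> : 1 = (7 / 8)%:C%:A + 8^-1%:C%:A :> B.
      rewrite -scalerDl -(rmorphD (real_complex R)) /= (_ : 7 / 8 + 8^-1 = 1 :> R) ?scale1r//.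
      by field.
    by ncring.
  by apply: cone_unit; [lra|exact: coneD].
have hE : 1 + h = (1 - n) * (1 + 1 + h).
  by rewrite mulrBl mulVr// mul1r; ncring.
rewrite hE unitrMr//.
have : (1 - n) * (1 + n + n) \is a GRing.unit.
  by rewrite (_ : _ * _ = 1 + Y)// YE; ncring.
by rewrite unitrM_comm; [case/andP|rewrite /GRing.comm; ncring].
Qed.

(* Halving x^* x often enough makes its norm < 1, where the claim is clear. *)
Lemma unit_1D_starM x : 1 + star x * x \is a GRing.unit.
Proof.
have [n xn] : exists n, nrm x ^+ 2 < 2 ^+ n.
  exists (Num.bound (nrm x ^+ 2)).
  by apply: upper_nthrootP; rewrite leqnn.
elim: n x xn => [|n ih] x xn.
  have := @unit_scalarD 1 (star x * x); rewrite rmorph1 scale1r nrm_starM.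
  by rewrite expr0 in xn; apply.
apply: unit_2D_1D.
pose a : R := Num.sqrt 2^-1.
have aa : a * a = 2^-1 by rewrite -expr2 sqr_sqrtr.
have := ih (a%:C *: x); rewrite nrmZ exprMn real_normK ?num_real// (expr2 a) aa.
rewrite ltr_pdivrMl// -exprS => /(_ xn).
rewrite starZr -scalerAl -scalerAr scalerA -rmorphM aa -(@unit_scale 2)// scalerDr scalerA.
by rewrite -rmorphM divff// rmorph1 scale1r (rmorph_nat (real_complex R)) scaler_nat.
Qed.

Lemma unit_scalarD_starM (a : R) x : 0 < a -> a%:C%:A + star x * x \is a GRing.unit.
Proof.
move=> a0; pose b := Num.sqrt a^-1.
have bb : b * b = a^-1 by rewrite -expr2 sqr_sqrtr// invr_ge0 ltW.
rewrite -(@unit_scale a^-1) ?invr_eq0 ?gt_eqF// scalerDr scalerA -rmorphM mulVf ?gt_eqF//.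
rewrite scale1r -bb rmorphM -scalerA scalerAr scalerAl -starZr.
exact: unit_1D_starM.
Qed.

(** If [n = nrm x ^+ 2] exceeded 1, then [n - star x * x = (n - 1) + star y * y] would be a unit, as
    is [n + star x * x], against [sa_spectrum]. So a contraction is certified by exhibiting its
    complement [y]. *)
Lemma nrm_le1_of_add x y : star x * x + star y * y = 1 -> nrm x <= 1.
Proof.
move=> xy; rewrite -(@expr_le1 _ 2%N) ?nrm_ge0// leNgt; apply/negP => x1.
have sx : star (star x * x) = star x * x by rewrite starM starK.
have x0 : 0 < nrm (star x * x) by rewrite nrm_starM (lt_trans _ x1).
apply: (sa_spectrum sx x0); last exact: unit_scalarD_starM.
rewrite nrm_starM.
have -> : (nrm x ^+ 2)%:C%:A - star x * x = (nrm x ^+ 2 - 1)%:C%:A + star y * y :> B.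
  by rewrite rmorphB scalerBl rmorph1 scale1r -xy; ncring.
by apply: unit_scalarD_starM; rewrite subr_gt0.
Qed.

End CStarTheory.

(** * Moebius maps *)

Section Moebius.
Variables (R : realType) (B : cstarAlgType R).
Implicit Types (x y z a d s t : B).

(** Here [p] and [q] invert [1 - d * star d] and [1 - star d * d]. The computation rests on the
    intertwining relations [p * d = d * q] and [star d * p = q * star d], and on
    [p = 1 + d * q * star d]. *)
Lemma moebius_kernel a d p q : (1 - d * star d) * p = 1 -> p * (1 - d * star d) = 1 ->
  (1 - star d * d) * q = 1 -> q * (1 - star d * d) = 1 ->
  (star d - star a) * p * (d - a) + (1 - star a * a) =
  (1 - star a * d) * q * (1 - star d * a).
Proof.
move=> pr pl qr ql.
have pd : p * d = d * q.
  have -> : p * d = p * (d * ((1 - star d * d) * q)) by rewrite qr mulr1.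
  have -> : p * (d * ((1 - star d * d) * q)) = (p * (1 - d * star d)) * (d * q) by ncring.
  by rewrite pl mul1r.
have dp : star d * p = q * star d.
  have -> : star d * p = (q * (1 - star d * d)) * (star d * p) by rewrite ql mul1r.
  have -> : q * (1 - star d * d) * (star d * p) = q * star d * ((1 - d * star d) * p) by ncring.
  by rewrite pr mulr1.
have pE : p = 1 + d * q * star d.
  have -> : 1 + d * q * star d = p * (1 - d * star d) + d * q * star d by rewrite pl.
  by rewrite -pd; ncring.
have qE : 1 + q * star d * d = q.
  by rewrite -[X in X + _]ql; ncring.
have -> : (star d - star a) * p * (d - a) =
    (star d * p) * (d - a) - star a * (p * d) + star a * p * a by ncring.
rewrite dp pd pE.
have -> : q * star d * (d - a) - star a * (d * q) + star a * (1 + d * q * star d) * a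
    + (1 - star a * a) = 1 + q * star d * d
      - q * star d * a - star a * d * q + star a * d * q * star d * a by ncring.
by rewrite qE; ncring.
Qed.

Lemma sa_sqr_unit s : s * s \is a GRing.unit -> s \is a GRing.unit.
Proof. by rewrite unitrM_comm ?andbb. Qed.

(** The complement for [nrm_le1_of_add] is [c = t * e * s2] with [t * t = 1 - star a * a]: by
    [moebius_kernel] the two squares add up to 1. *)
Lemma nrm_moebius_le1 a d s1 s2 : nrm a < 1 -> nrm d < 1 ->
  star s1 = s1 -> s1 * s1 = 1 - d * star d ->
  star s2 = s2 -> s2 * s2 = 1 - star d * d ->
  nrm (s1^-1 * (d - a) * (1 - star d * a)^-1 * s2) <= 1.
Proof.
move=> a1 d1 ss1 s1E ss2 s2E; set e := (1 - _)^-1.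
have ltM (u v : B) : nrm u < 1 -> nrm v < 1 -> nrm (u * v) < 1.
  move=> u1 v1; rewrite (le_lt_trans (nrmM _ _))//.
  by rewrite mulr_ilt1 ?nrm_ge0.
have dd1 : nrm (d * star d) < 1 by rewrite ltM ?nrm_star.
have dd2 : nrm (star d * d) < 1 by rewrite ltM ?nrm_star.
have us1 : s1 \is a GRing.unit by rewrite sa_sqr_unit// s1E unit_1B.
have us2 : s2 \is a GRing.unit by rewrite sa_sqr_unit// s2E unit_1B.
have ue : 1 - star d * a \is a GRing.unit by rewrite unit_1B// ltM ?nrm_star.
have aa1 : nrm (star a * a) < 1 by rewrite ltM ?nrm_star.
have saa : star (star a * a) = star a * a by rewrite starM starK.
have [t [st tE _ _ _]] := sa_sqrt_1B saa (lexx _) aa1.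
pose c := t * e * s2.
apply: (@nrm_le1_of_add _ _ _ c).
rewrite /c !starM starB st ss2 (starV us1) ss1.
have -> : s2 * (star e * ((star d - star a) * s1^-1)) * (s1^-1 * (d - a) * e * s2)
   + s2 * (star e * t) * (t * e * s2) =
   s2 * star e * ((star d - star a) * (s1^-1 * s1^-1) * (d - a) + t * t) * e * s2 by ncring.
rewrite tE (@moebius_kernel a d (s1^-1 * s1^-1) (s2^-1 * s2^-1)).
- have -> : star e = (1 - star a * d)^-1 by rewrite /e starV// starB star1 starM starK.
  have ue' : 1 - star a * d \is a GRing.unit.
    by have := star_unit ue; rewrite starB star1 starM starK.
  have -> : s2 * (1 - star a * d)^-1 *
      ((1 - star a * d) * (s2^-1 * s2^-1) * (1 - star d * a)) * e * s2 =
      s2 * (((1 - star a * d)^-1 * (1 - star a * d)) *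
        (s2^-1 * (s2^-1 * (((1 - star d * a) * e) * s2)))) by ncring.
  by rewrite mulrV// mulVr// !mul1r mulVr// mulr1 mulrV.
- by rewrite -s1E -invrM// mulrV// unitrMr.
- by rewrite -s1E -invrM// mulVr// unitrMr.
- by rewrite -s2E -invrM// mulrV// unitrMr.
- by rewrite -s2E -invrM// mulVr// unitrMr.
Qed.

(** * Location of spectra and independence of [rho] from the roots *)

Lemma unit_cscalarB (l : R[i]) x : nrm x < complex.Re `|l| -> l%:A - x \is a GRing.unit.
Proof.
move=> xl.
have l0 : l != 0.
  by apply: contraTneq xl => ->; rewrite normr0/= -leNgt nrm_ge0.
have lE : `|l| = (complex.Re `|l|)%:C by rewrite RRe_real// normr_real.
rewrite -(@scaler_unit _ _ l^-1) ?unitfE ?invr_eq0// scalerBr scalerA mulVf// scale1r.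
apply: unit_1B; rewrite -ltcR -nrmE normrZ normfV nrmE.
by rewrite mulrC ltr_pdivrMr ?normr_gt0// mul1r lE ltcR.
Qed.

Lemma Re_norm_ge0 (l : R[i]) : 0 <= complex.Re `|l|.
Proof. by rewrite normc_def /= sqrtr_ge0. Qed.

Lemma Re_norm_sqr (l : R[i]) :
  complex.Re `|l| ^+ 2 = complex.Re l ^+ 2 + complex.Im l ^+ 2.
Proof. by rewrite normc_def /= sqr_sqrtr// addr_ge0 ?sqr_ge0. Qed.

(** [csqrt] is an arbitrary choice with default 0, so a positive root must be exhibited: the root of
    [sa_sqrt_1B], once its spectrum is shown to lie in the nonnegative reals. *)
Lemma csqrt_spec x : star x = x -> nrm x < 1 ->
  star (csqrt (1 - x)) = csqrt (1 - x) /\ csqrt (1 - x) * csqrt (1 - x) = 1 - x.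
Proof.
move=> sx x1; rewrite /csqrt; set S := [set s | _].
suff : S !=set0.
  by move=> /(xgetPex 0)[[ss _]]; rewrite expr2.
have [s [ss sE s1 _ _]] := sa_sqrt_1B sx (lexx _) x1.
exists s; split; last by rewrite expr2.
split=> // l; rewrite /spectrum /= => ul.
(* For [b] nonzero, the shift by [i t] gives [(b + t)^2 <= nrm s ^+ 2 + t^2], which fails because
   [t] is chosen with [2 b t = nrm s ^+ 2 + 1]. *)
have Im0 : complex.Im l = 0.
  apply/eqP; apply: contraT => l0; set b := complex.Im l in l0.
  pose t := (nrm s ^+ 2 + 1) / (2 * b).
  have : complex.Re `|l + 'i%C * t%:C| <= nrm (s + ('i%C * t%:C)%:A).
    rewrite leNgt; apply: contra ul => /unit_cscalarB.
    have -> : (l + 'i%C * t%:C)%:A - (s + ('i%C * t%:C)%:A) = - (s - l%:A) :> B.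
      by rewrite scalerDl; ncring.
    by rewrite unitrN.
  rewrite -ler_sqr ?nnegrE ?nrm_ge0// ?Re_norm_ge0// Re_norm_sqr -nrm_starM.
  have -> : star (s + ('i%C * t%:C)%:A) * (s + ('i%C * t%:C)%:A) = s * s + (t * t)%:C%:A.
    have -> : star (s + ('i%C * t%:C)%:A) = s - ('i%C * t%:C)%:A.
      rewrite starD ss starZ star1 -scaleNr; congr (_ + _ *: _).
      by apply/eqP; rewrite eq_complex /=; apply/andP; split; apply/eqP; ring.
    rewrite mulrDr !mulrBl mulr_algl mulr_algr mulr_algl scalerA.
    have -> : 'i%C * t%:C * ('i%C * t%:C) = - (t * t)%:C :> R[i].
      by rewrite mulrACA -expr2 sqr_i mulN1r -rmorphM.
    by rewrite scaleNr; ncring.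
  move=> h; have := le_trans h (nrmD _ _).
  rewrite nrm_scalar nrm_sa// -(expr2 t) ger0_norm ?sqr_ge0//.
  have [-> ->] : complex.Re (l + 'i%C * t%:C) = complex.Re l /\
      complex.Im (l + 'i%C * t%:C) = b + t.
    by rewrite /b; case: (l) => p q /=; split; ring.
  have bt : 2 * b * t = nrm s ^+ 2 + 1 by rewrite /t mulrC divfK// mulf_neq0.
  by have := sqr_ge0 (complex.Re l); have := sqr_ge0 b; lra.
(* The spectrum of [s] lies in the disc of radius [nrm (1 - s) < 1] around 1, hence in the right
   half-plane. *)
have : complex.Re `|1 - l| <= nrm (1 - s).
  rewrite leNgt; apply: contra ul => /unit_cscalarB.
  have -> : (1 - l)%:A - (1 - s) = s - l%:A :> B by rewrite scalerBl scale1r; ncring.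
  by [].
rewrite -ler_sqr ?nnegrE ?nrm_ge0 ?Re_norm_ge0// Re_norm_sqr.
have : nrm (1 - s) ^+ 2 < 1 by rewrite expr_lt1 ?nrm_ge0// (le_lt_trans s1).
have [-> ->] : complex.Re (1 - l) = 1 - complex.Re l /\
    complex.Im (1 - l) = - complex.Im l.
  by case: (l) => p q /=; split; ring.
rewrite Im0 lecE /= Im0 eqxx /= => h1 h2.
have := sqr_ge0 (complex.Re l); nra.
Qed.

Lemma nrm_eq_starM x y : star x * x = star y * y -> nrm x = nrm y.
Proof.
move=> xy; apply/eqP; rewrite -(@eqrXn2 _ 2%N) ?nrm_ge0//.
by rewrite -!nrm_starM xy.
Qed.

(* This and the next lemma show that rho does not depend on which self-adjoint
   square roots are used, so uniqueness of the positive root is not needed. *)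
Lemma nrm_invl_sqr s t z : star s = s -> star t = t ->
  s \is a GRing.unit -> t \is a GRing.unit -> s * s = t * t ->
  nrm (s^-1 * z) = nrm (t^-1 * z).
Proof.
move=> ss st us ut sE; apply: nrm_eq_starM; rewrite !starM !starV// ss st.
have E (v : B) : star z * v * (v * z) = star z * (v * v) * z by ncring.
by rewrite !E -!invrM// sE.
Qed.

Lemma nrm_mulr_sqr s t z : star s = s -> star t = t -> s * s = t * t ->
  nrm (z * s) = nrm (z * t).
Proof.
move=> ss st sE; rewrite -nrm_star -[RHS]nrm_star; apply: nrm_eq_starM.
rewrite !starM !starK ss st.
have E (v : B) : z * v * (v * star z) = z * (v * v) * star z by ncring.
by rewrite !E sE.
Qed.

(** Allows convenient self-adjoint roots: ones known to lie in [D], or simply 1 when [x = 0]. *)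
Lemma rhoE x y s t : nrm x < 1 -> star s = s -> star t = t ->
  s * s = 1 - x * star x -> t * t = 1 - star x * x ->
  rho x y = atanh (nrm (s^-1 * (x - y) * (1 - star x * y)^-1 * t)).
Proof.
move=> x1 ss st sE tE.
have x2 : nrm (x * star x) < 1.
  by rewrite -{1}[x]starK nrm_starM nrm_star expr_lt1 ?nrm_ge0.
have x3 : nrm (star x * x) < 1 by rewrite nrm_starM expr_lt1 ?nrm_ge0.
have [|cs cE] := @csqrt_spec (x * star x) _ x2; first by rewrite starM starK.
have [|ct ctE] := @csqrt_spec (star x * x) _ x3; first by rewrite starM starK.
rewrite /rho (@nrm_mulr_sqr _ t)//; last by rewrite ctE tE.
rewrite -!mulrA (@nrm_invl_sqr _ s)//.
- by rewrite sa_sqr_unit// cE unit_1B.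
- by rewrite sa_sqr_unit// sE unit_1B.
- by rewrite cE sE.
Qed.

End Moebius.

(** * Scalar Moebius maps *)

Section ScalarMoebius.
Variables (R : realType) (B : cstarAlgType R).
Implicit Types (x y z g : B) (r t : R).

Lemma scalar_unit r : r != 0 -> r%:C%:A \is a @GRing.unit B.
Proof. by move=> r0; rewrite unit_scale ?unitr1. Qed.

Lemma unit_1BZ r x : 0 <= r -> r < 1 -> nrm x <= 1 -> 1 - r%:C *: x \is a GRing.unit.
Proof.
move=> r0 r1 x1; rewrite unit_1B// nrmZ ger0_norm// (le_lt_trans _ r1)//.
by rewrite ler_piMr.
Qed.

(** The case [d = r] of [nrm_moebius_le1], where both roots are the same scalar and cancel. *)
Lemma nrm_scalar_moebius_le1 r x : 0 <= r -> r < 1 -> nrm x < 1 ->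
  nrm ((r%:C%:A - x) * (1 - r%:C *: x)^-1) <= 1.
Proof.
move=> r0 r1 x1; pose s : B := (Num.sqrt (1 - r * r))%:C%:A.
have rr : 0 < 1 - r * r by rewrite subr_gt0 mulr_ilt1.
have sr : star (r%:C%:A : B) = r%:C%:A by rewrite starZr star1.
have ss : star s = s by rewrite /s starZr star1.
have sE : s * s = 1 - r%:C%:A * r%:C%:A.
  rewrite /s !mulr_algl !scalerA -!rmorphM -expr2 sqr_sqrtr ?(ltW rr)//.
  by rewrite rmorphB scalerBl rmorph1 scale1r.
have us : s \is a GRing.unit by rewrite scalar_unit// gt_eqF// sqrtr_gt0.
have := @nrm_moebius_le1 _ _ x r%:C%:A s s x1; rewrite sr nrm_scalar ger0_norm//.
move=> /(_ r1 ss sE ss sE); rewrite mulr_algl -!mulrA.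
rewrite (_ : (1 - r%:C *: x)^-1 * s = s * (1 - r%:C *: x)^-1); last first.
  by rewrite /s mulr_algr mulr_algl.
rewrite (_ : (r%:C%:A - x) * (s * (1 - r%:C *: x)^-1) =
  s * ((r%:C%:A - x) * (1 - r%:C *: x)^-1)); last first.
  by rewrite /s !mulr_algl scalerAr.
by rewrite mulKr.
Qed.

Lemma one_sub_moebius r x : 1 - r%:C *: x \is a GRing.unit ->
  1 - (r%:C%:A - x) * (1 - r%:C *: x)^-1 =
  (1 - r)%:C *: ((1 + x) * (1 - r%:C *: x)^-1).
Proof.
move=> u; rewrite -{1}(mulrV u) -mulrBl scalerAl; congr (_ * _).
by rewrite rmorphB scalerBl rmorph1 scale1r scalerDr; ncring.
Qed.

(** The left side is the value of [z |-> 1 - (r - z) / (1 - r z)] at the spectral point [nrm g ^+ 2]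
    of [g * g]. Identity [E] carries this point to the spectrum of the image, which bounds the norm
    from below. *)
Lemma nrm_one_sub_moebius_ge r g : star g = g -> 0 < nrm g -> nrm g < 1 ->
  0 <= r -> r < 1 ->
  (1 - r) * (1 + nrm g ^+ 2) / (1 - r * nrm g ^+ 2) <=
  nrm (1 - (r%:C%:A - g * g) * (1 - r%:C *: (g * g))^-1).
Proof.
move=> sg g0 g1 r0 r1; set t := nrm g ^+ 2; set p := g * g.
have t1 : t < 1 by rewrite /t expr_lt1// ltW.
have t0 : 0 <= t by rewrite sqr_ge0.
have up : 1 - r%:C *: p \is a GRing.unit.
  by rewrite unit_1BZ// nrm_sa// ltW.
have rt : 0 < 1 - r * t by rewrite subr_gt0 mulr_ilt1.
have rr : 0 < 1 - r * r by rewrite subr_gt0 mulr_ilt1.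
rewrite leNgt; apply/negP => /unit_scalarB; apply/negP.
have := sqr_not_unit sg g0; rewrite -/p -/t; apply: contra => u.
rewrite one_sub_moebius// in u.
have E : (1 - r * r)%:C *: ((t%:C%:A - p) * (1 - r%:C *: p)^-1) =
  (1 - r * t)%:C *: (((1 - r) * (1 + t) / (1 - r * t))%:C%:A -
     (1 - r)%:C *: ((1 + p) * (1 - r%:C *: p)^-1)).
  have -> : (1 - r * t)%:C *: (((1 - r) * (1 + t) / (1 - r * t))%:C%:A -
     (1 - r)%:C *: ((1 + p) * (1 - r%:C *: p)^-1)) =
     (((1 - r) * (1 + t))%:C *: (1 - r%:C *: p) - ((1 - r * t) * (1 - r))%:C *: (1 + p))
     * (1 - r%:C *: p)^-1.
    rewrite [RHS]mulrBl -!scalerAl mulrV// scalerBr !scalerA -!(rmorphM (real_complex R)) /=.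
    by congr (_%:C *: _ - _); rewrite [LHS]mulrC; exact: (divfK (lt0r_neq0 rt)).
  rewrite scalerAl; congr (_ * _).
  rewrite !scalerBr scalerDr !scalerA -!(rmorphM (real_complex R)) opprD addrACA -scalerBl.
  rewrite -opprD -scalerDl -(rmorphB (real_complex R)) -(rmorphD (real_complex R)) /=.
  by congr (_%:C *: _ - _%:C *: _); ring.
have : (t%:C%:A - p) * (1 - r%:C *: p)^-1 \is a GRing.unit.
  by rewrite -(@unit_scale _ _ (1 - r * r)) ?gt_eqF// E unit_scale// gt_eqF.
by rewrite unitrMl// unitrV.
Qed.

End ScalarMoebius.

(** * Monotonicity and bounds of [atanh] *)

Section Atanh.
Variable R : realType.
Implicit Types (v k M : R).

Lemma le_atanh v k : 0 <= v -> v <= k -> k < 1 -> atanh v <= atanh k.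
Proof.
move=> v0 vk k1; have v1 : v < 1 by exact: le_lt_trans k1.
rewrite /atanh ler_wpM2r ?invr_ge0// ler_ln ?posrE ?divr_gt0 ?subr_gt0//; try lra.
by rewrite ler_pM ?invr_ge0 ?lef_pV2 ?posrE ?subr_gt0//; lra.
Qed.

(** The constant is the hyperbolic tangent of [M], written with [E = exp (2 M)]. *)
Lemma atanh_bounded M : 0 < M ->
  exists2 k : R, 0 < k < 1 & forall v, 0 <= v -> v < 1 -> atanh v <= M -> v <= k.
Proof.
move=> M0; pose E := expR (M * 2).
have E1 : 1 < E by rewrite /E -expR0 ltr_expR mulr_gt0.
exists ((E - 1) / (E + 1)) => [|v v0 v1].
  by rewrite divr_gt0 ?ltr_pdivrMr; lra.
have v2 : 0 < (1 + v) / (1 - v) by rewrite divr_gt0 ?subr_gt0//; lra.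
rewrite /atanh ler_pdivrMr// => vM.
have : expR (ln ((1 + v) / (1 - v))) <= E by rewrite ler_expR.
by rewrite lnK ?posrE// ler_pdivrMr ?subr_gt0// ler_pdivlMr; lra.
Qed.

End Atanh.

(** * D-characters *)

Section BCharacters.
Variables (R : realType) (B : cstarAlgType R) (A D : operatorAlgebra B).
Hypothesis D_star : forall x : B, x \in D -> star x \in D.
Hypothesis DA : {subset D <= A}.

(* D-characters of A as total maps of B, whose values outside A are irrelevant. *)
Record is_dchar (f : B -> B) : Prop := IsDChar {
  dc_mem : forall x, x \in A -> f x \in D;
  dcB : forall x y, x \in A -> y \in A -> f (x - y) = f x - f y;
  dcM : forall x y, x \in A -> y \in A -> f (x * y) = f x * f y;
  dcZ : forall (l : R[i]) x, x \in A -> f (l *: x) = l *: f x;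
  dc_id : forall x, x \in D -> f x = x;
  dc_le : forall x, x \in A -> nrm (f x) <= nrm x }.

Implicit Types f g : B -> B.

(** An operator norm is below 2 exactly when one real [k < 2] bounds all values on the unit ball;
    explicit constants keep the estimates within [R]. [contracts_ker] does the same for a norm below
    1 on a kernel. *)
Definition close f g := exists2 k : R, k < 2 &
  forall x, x \in A -> nrm x <= 1 -> nrm (f x - g x) <= k.

Definition contracts_ker f g := exists2 k : R, k < 1 &
  forall x, x \in A -> nrm x <= 1 -> g x = 0 -> nrm (f x) <= k.

Lemma dc1 f : is_dchar f -> f 1 = 1.
Proof. by move=> fd; rewrite dc_id// rpred1. Qed.

Lemma dcV f x : is_dchar f -> x \in A -> x^-1 \in A -> x \is a GRing.unit ->
  f x^-1 = (f x)^-1.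
Proof.
move=> fd xA VA ux; apply/esym/invr_unique; rewrite -dcM//.
  by rewrite mulVr// dc1.
by rewrite mulrV// dc1.
Qed.

Lemma close_sym f g : close f g -> close g f.
Proof. by move=> [k k2 h]; exists k => // x xA x1; rewrite nrmC h. Qed.

(** The element [(x - g x) / 2] lies in the unit ball and in the kernel of [g], and [f] sends it to
    [(f x - g x) / 2] since both maps fix [D]. *)
Lemma contracts_ker_close f g : is_dchar f -> is_dchar g ->
  contracts_ker f g -> close f g.
Proof.
move=> fd gd [k k1 h]; exists (2 * k) => [|x xA x1]; first by lra.
have gD := dc_mem gd xA.
pose y := 2^-1%:C *: (x - g x).
have dA : x - g x \in A by rewrite rpredB// DA.
have yA : y \in A by rewrite rpredZ.
have y1 : nrm y <= 1.
  rewrite nrmZ ger0_norm ?invr_ge0// ler_pdivrMl//.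
  by have := nrmB x (g x); have := dc_le gd xA; lra.
have := h y yA y1; rewrite /y (dcZ fd)// (dcZ gd)// (dcB fd) ?(DA gD)// (dcB gd) ?(DA gD)//.
rewrite (dc_id fd gD) (dc_id gd gD) subrr scaler0 => /(_ erefl).
by rewrite nrmZ ger0_norm ?invr_ge0//; lra.
Qed.

Lemma mem_scalar (E : operatorAlgebra B) (l : R[i]) : l%:A \in E.
Proof. by rewrite rpredZ ?rpred1. Qed.

Lemma dc_moebius f r x : is_dchar f -> 0 <= r -> r < 1 -> x \in A -> nrm x <= 1 ->
  f ((r%:C%:A - x) * (1 - r%:C *: x)^-1) =
  (r%:C%:A - f x) * (1 - r%:C *: f x)^-1.
Proof.
move=> fd r0 r1 xA x1.
have rx : nrm (r%:C *: x) < 1.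
  by rewrite nrmZ ger0_norm// (le_lt_trans _ r1)// ler_piMr.
have VA : (1 - r%:C *: x)^-1 \in A by rewrite mem_inv_1B// rpredZ.
have A1 : 1 - r%:C *: x \in A by rewrite rpredB ?rpred1 ?rpredZ.
rewrite (dcM fd) ?rpredB ?mem_scalar// (dcV fd) ?unit_1B// !(dcB fd) ?rpred1 ?mem_scalar ?rpredZ//.
by rewrite !(dcZ fd) ?rpred1// (dc1 fd).
Qed.

(** Used twice: [s = 0] gives contraction on kernels, and [s] near 1 gives the condition on
    sequences. *)
Lemma close_norm_gt f g (s : R) : is_dchar f -> is_dchar g -> close f g ->
  0 <= s -> s < 1 -> exists2 eta : R, eta < 1 &
    forall x, x \in A -> nrm x <= 1 -> eta < nrm (f x) -> s < nrm (g x).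
Proof.
move=> fd gd [k k2 fgk] s0 s1.
have k0 : 0 <= k.
  by have := fgk 0 (rpred0 _); rewrite nrm0 ler01 => /(_ isT); apply: le_trans; exact: nrm_ge0.
(* The gap is encoded as [k = 2 - 4 e]. With [q = 1 - r], the choice of [q] puts the image under [g]
   within [e] of 1, and [eta] makes the image under [f] more than [2 - 3 e = k + e] away from 1. *)
pose e := (2 - k) / 4; have e0 : 0 < e by rewrite /e; lra.
have e1 : e <= 2^-1 by rewrite /e; lra.
pose q := e * (1 - s) / 2.
have q0 : 0 < q by rewrite /q divr_gt0// mulr_gt0// subr_gt0.
have q1 : q <= 4^-1 by rewrite /q; nra.
pose r := 1 - q; have r0 : 0 <= r by rewrite /r; lra.
have r1 : r < 1 by rewrite /r; lra.
pose eta := 1 - e * q / 10.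
have eta1 : eta < 1 by rewrite /eta; nra.
have eta0 : 0 < eta by rewrite /eta; nra.
exists eta => // x xA x1 dx; rewrite ltNge; apply/negP => gxs.
set d := f x in dx; have dD : d \in D by exact: dc_mem.
have d1 : nrm d <= 1 by rewrite (le_trans (dc_le fd xA)).
have sdD := D_star dD.
(* Then [f a = d * z] is [eta (d * star d)^2], the square of [h]; the factor [eta] makes [nrm a < 1]
   strict. *)
pose z := eta%:C *: (star d * d * star d); pose a := x * z.
have zD : z \in D by rewrite rpredZ// !rpredM.
have aA : a \in A by rewrite rpredM// DA.
have z1 : nrm z <= eta.
  rewrite nrmZ gtr0_norm// ler_piMr ?(ltW eta0)//.
  rewrite (le_trans (nrmM _ _))// nrm_starM nrm_star.
  by rewrite mulr_ile1 ?nrm_ge0 ?sqr_ge0 ?expr_le1 ?nrm_ge0.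
have a1 : nrm a < 1.
  rewrite (le_lt_trans (nrmM _ _))// (le_lt_trans _ eta1)// (le_trans _ z1)//.
  by rewrite ler_piMl ?nrm_ge0.
pose h := (Num.sqrt eta)%:C *: (d * star d).
have sh : star h = h by rewrite starZr starM starK.
have hh : h * h = d * z.
  by rewrite /h /z -scalerAl -!scalerAr scalerA -rmorphM -expr2 sqr_sqrtr ?(ltW eta0)// !mulrA.
have nh : nrm h ^+ 2 = eta * nrm d ^+ 4.
  rewrite nrmZ exprMn real_normK ?num_real// sqr_sqrtr ?(ltW eta0)//.
  by rewrite -{1}[d]starK nrm_starM nrm_star -exprM.
set t := nrm h ^+ 2 in nh.
(* [t >= eta^5 >= 1 - 5 (1 - eta)], as in Bernoulli's inequality, and [5 (1 - eta) = e q / 2]. *)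
have te : 1 - e * q / 2 <= t.
  have w0 : 0 < 1 - eta by rewrite subr_gt0.
  have w1 : e * q / 2 = 5 * (1 - eta) by rewrite /eta; lra.
  have eta4 : 1 - 4 * (1 - eta) <= eta ^+ 4.
    have := sqr_ge0 (1 - eta); have := sqr_ge0 (1 - eta ^+ 2).
    by rewrite !expr2 -[4%N]/(2 * 2)%N exprM !expr2; lra.
  have d4 : eta ^+ 4 <= nrm d ^+ 4 by rewrite lerXn2r ?nnegrE ?(ltW eta0) ?nrm_ge0 ?(ltW dx).
  have := ler_wpM2l (ltW eta0) (le_trans eta4 d4); rewrite -nh.
  by have := sqr_ge0 (1 - eta); rewrite expr2; lra.
have t1 : t < 1.
  by rewrite nh (le_lt_trans _ eta1)// ler_piMr ?(ltW eta0)// expr_le1 ?nrm_ge0.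
have h0 : 0 < nrm h.
  rewrite lt_def nrm_ge0 andbT; apply: contraTneq te; rewrite /t => ->.
  have eq1 : e * q <= 2^-1 * 4^-1 by rewrite ler_pM ?(ltW e0) ?(ltW q0).
  by rewrite expr0n /= -ltNge; lra.
have h1 : nrm h < 1 by rewrite -(@expr_lt1 _ 2%N)// nrm_ge0.
pose b := (r%:C%:A - a) * (1 - r%:C *: a)^-1.
have bA : b \in A.
  rewrite rpredM ?rpredB ?mem_scalar// mem_inv_1B ?rpredZ//.
  by rewrite nrmZ ger0_norm// mulr_ilt1 ?nrm_ge0.
have b1 : nrm b <= 1 by exact: nrm_scalar_moebius_le1.
have := fgk b bA b1; rewrite /b (dc_moebius fd)// ?(ltW a1)// (dc_moebius gd)// ?(ltW a1)//.
rewrite (dcM fd) ?(DA zD)// (dcM gd) ?(DA zD)// (dc_id fd zD) (dc_id gd zD).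
rewrite -/d -hh; set y := g x * z; set fb := _ * (1 - r%:C *: (h * h))^-1; set gb := _ / _.
have ys : nrm y <= s.
  rewrite (le_trans (nrmM _ _))// (le_trans _ gxs)// ler_piMr ?nrm_ge0//.
  exact: le_trans (ltW eta1).
have fb_ge := nrm_one_sub_moebius_ge sh h0 h1 r0 r1; rewrite -/fb -/t in fb_ge.
have gb_le : nrm (1 - gb) <= e.
  have ry : nrm (r%:C *: y) <= s.
    by rewrite nrmZ ger0_norm// (le_trans _ ys)// ler_piMl ?nrm_ge0 ?ltW.
  have ry1 : nrm (r%:C *: y) < 1 by exact: le_lt_trans s1.
  rewrite one_sub_moebius ?unit_1B// nrmZ /r subKr gtr0_norm// mulrC.
  rewrite -ler_pdivlMr// (le_trans (nrmM _ _))//.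
  have n1 : nrm (1 + y) <= 2 by rewrite (le_trans (nrmD _ _))// nrm1; lra.
  have n2 : nrm (1 - r%:C *: y)^-1 <= (1 - s)^-1.
    by rewrite (le_trans (nrm_inv_1B ry1))// lef_pV2 ?posrE ?subr_gt0//; lra.
  rewrite (le_trans (ler_pM _ _ n1 n2)) ?nrm_ge0//.
  have -> : e / q = 2 / (1 - s).
    by rewrite /q; field; rewrite !gt_eqF ?subr_gt0.
  by [].
move=> kle.
have : nrm (1 - fb) <= k + e.
  rewrite (_ : 1 - fb = (1 - gb) - (fb - gb)); last by ncring.
  by rewrite (le_trans (nrmB _ _))// addrC lerD.
move=> /(le_trans fb_ge).
have rt : 0 < 1 - r * t by rewrite subr_gt0 mulr_ilt1// sqr_ge0.
rewrite ler_pdivrMr//.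
have -> : k + e = 2 - 3 * e by rewrite /e; lra.
apply/negP; rewrite -ltNge /r subKr.
(* What remains is [(2 - 3 e) (1 - r t) < q (1 + t)]; the sign and size of each product are recorded
   so that linear arithmetic concludes. *)
have u0 : 0 <= 1 - t by lra.
have p1 : 0 <= e * (1 - t) by rewrite mulr_ge0 ?(ltW e0).
have p2 : 0 <= q * (1 - t) by rewrite mulr_ge0 ?(ltW q0).
have p3 : 0 <= e * (q * (1 - t)) by rewrite mulr_ge0 ?(ltW e0).
have p4 : q * (1 - t) <= 4^-1 * (1 - t) by rewrite ler_wpM2r.
have p5 : e * (q * (1 - t)) <= 2^-1 * (q * (1 - t)) by rewrite ler_wpM2r.
have p6 : 0 < e * q by rewrite mulr_gt0.
rewrite (_ : (2 - 3 * e) * (1 - (1 - q) * t) = 2 * (1 - t) - 3 * (e * (1 - t))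
  + (2 * q - 3 * (e * q)) - 2 * (q * (1 - t)) + 3 * (e * (q * (1 - t)))); last by ring.
rewrite (_ : q * (1 + t) = 2 * q - q * (1 - t)); last by ring.
by lra.
Qed.

Lemma close_contracts_ker f g : is_dchar f -> is_dchar g ->
  close f g -> contracts_ker f g.
Proof.
move=> fd gd /(close_norm_gt fd gd)/(_ (lexx 0) ltr01)[eta eta1 h].
exists eta => // x xA x1 gx; rewrite leNgt; apply/negP => /(h x xA x1).
by rewrite gx nrm0 ltxx.
Qed.

(** * Bounded [rho] against contraction on kernels *)

Definition rho_bounded f g := exists2 M : R, 0 < M &
  forall x, x \in A -> nrm x < 1 -> rho (f x) (g x) <= M.

Lemma rho0 x : rho (0 : B) x = atanh (nrm x).
Proof.
rewrite (@rhoE _ _ 0 x 1 1) ?nrm0 ?star1 ?star0 ?mulr0 ?mul0r ?subr0 ?mulr1//.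
by rewrite sub0r !(invr1, mul1r, mulr1) nrmN.
Qed.

Lemma rho_bounded_contracts_ker f g : is_dchar f -> is_dchar g ->
  rho_bounded f g -> contracts_ker g f.
Proof.
move=> fd gd [M M0 h]; have [T /andP[T0 T1] hT] := atanh_bounded M0.
exists ((1 + T) / 2) => [|x xA x1 fx]; first by lra.
(* [rho_bounded] speaks of norms below 1, so [x] is scaled by [r < 1], chosen so that
   [T / r = (1 + T) / 2]. *)
pose r := 2 * T / (1 + T).
have r0 : 0 < r by rewrite divr_gt0 ?mulr_gt0//; lra.
have r1 : r < 1 by rewrite ltr_pdivrMr; lra.
have rxA : r%:C *: x \in A by rewrite rpredZ.
have gx1 : nrm (g x) <= 1 by rewrite (le_trans (dc_le gd xA)).
have rx1 : nrm (r%:C *: x) < 1.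
  by rewrite nrmZ gtr0_norm// (le_lt_trans _ r1)// ler_piMr// ltW.
have := h _ rxA rx1; rewrite (dcZ fd)// fx scaler0 (dcZ gd)// rho0 => /hT.
rewrite nrm_ge0 nrmZ gtr0_norm// => /(_ erefl).
have rg : r * nrm (g x) < 1 by rewrite (le_lt_trans _ r1)// ler_piMr// ltW.
move=> /(_ rg); rewrite /r mulrAC ler_pdivrMr; last by lra.
by rewrite -mulrA mulrCA ler_pM2l//; lra.
Qed.

Lemma contracts_ker_rho_bounded f g : is_dchar f -> is_dchar g ->
  contracts_ker g f -> rho_bounded f g.
Proof.
(* The maximum keeps [atanh m] positive even when [k <= 0]. *)
move=> fd gd [k k1 h]; pose m := Num.max k 2^-1.
have m1 : m < 1 by rewrite gt_max k1; lra.
have m0 : 0 < m by rewrite lt_max invr_gt0 ltr0n orbT.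
exists (atanh m) => [|x xA x1].
  rewrite /atanh divr_gt0// ln_gt0// ltr_pdivlMr; lra.
set d := f x; have dD : d \in D by exact: dc_mem.
have sdD := D_star dD.
have d1 : nrm d < 1 by rewrite (le_lt_trans (dc_le fd xA)).
have dd1 : nrm (d * star d) < 1.
  by rewrite -{1}[d]starK nrm_starM nrm_star expr_lt1 ?nrm_ge0.
have dd2 : nrm (star d * d) < 1 by rewrite nrm_starM expr_lt1 ?nrm_ge0.
have sdd1 : star (d * star d) = d * star d by rewrite starM starK.
have sdd2 : star (star d * d) = star d * d by rewrite starM starK.
have [s1 [ss1 s1E s11 _ s1D]] := sa_sqrt_1B sdd1 (lexx _) dd1.
have [s2 [ss2 s2E _ _ s2D]] := sa_sqrt_1B sdd2 (lexx _) dd2.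
have {}s1D : s1 \in D by rewrite s1D// rpredM.
have {}s2D : s2 \in D by rewrite s2D// rpredM.
(* [s1 = 1 - (1 - s1)] with [nrm (1 - s1) < 1], so the inverse stays in the closed algebra [D]. *)
have VD : s1^-1 \in D.
  rewrite -[s1](subKr 1) mem_inv_1B ?rpredB ?rpred1//.
  exact: le_lt_trans dd1.
have ltM y : nrm y < 1 -> nrm (star d * y) < 1.
  by move=> y1; rewrite (le_lt_trans (nrmM _ _))// nrm_star mulr_ilt1 ?nrm_ge0.
have wA : star d * x \in A by rewrite rpredM// DA.
have WA : 1 - star d * x \in A by rewrite rpredB ?rpred1.
have VA : (1 - star d * x)^-1 \in A by rewrite mem_inv_1B// ltM.
pose b := s1^-1 * (d - x) * (1 - star d * x)^-1 * s2.
(* Every D-character commutes with the Moebius map at [d]: taking [c = f] gives 0, taking [c = g]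
   gives the element inside [rho]. *)
have bE c : is_dchar c -> c b = s1^-1 * (d - c x) * (1 - star d * c x)^-1 * s2.
  move=> cd; rewrite /b !(dcM cd) ?rpredM ?rpredB ?rpred1// ?(DA VD)// ?(DA dD)// ?(DA s2D)//.
  have -> : c (d - x) = d - c x by rewrite (dcB cd) ?(DA dD)// (dc_id cd).
  have -> : c (1 - star d * x)^-1 = (1 - star d * c x)^-1.
    rewrite (dcV cd WA VA) ?unit_1B ?ltM// (dcB cd (rpred1 _) wA) (dc1 cd).
    by rewrite (dcM cd (DA sdD) xA) (dc_id cd sdD).
  by rewrite (dc_id cd VD) (dc_id cd s2D).
have bA : b \in A by rewrite !rpredM ?rpredB// DA.
have b1 : nrm b <= 1 by exact: nrm_moebius_le1.
have := h b bA b1; rewrite !bE// subrr mulr0 !mul0r => /(_ erefl) => hb.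
rewrite (rhoE _ d1 ss1 ss2)// le_atanh ?nrm_ge0//.
by rewrite (le_trans hb)// le_max lexx.
Qed.

End BCharacters.

(** * From D-characters as records to total maps on [B] *)

Section Bridge.
Variables (R : realType) (B : cstarAlgType R) (A D : operatorAlgebra B).
Implicit Types (Phi Psi : dcharacter A D).

Definition dchar_ext Phi (x : B) : B :=
  if insub x is Some a then (Phi a : B) else 0.

Lemma dchar_extE Phi (a : opalg_elt A) : dchar_ext Phi a = Phi a.
Proof. by rewrite /dchar_ext valK. Qed.

Lemma opalg_valB (E : operatorAlgebra B) (a b : opalg_elt E) :
  opalg_val (a - b) = opalg_val a - opalg_val b.
Proof. by []. Qed.

Lemma opalg_valM (E : operatorAlgebra B) (a b : opalg_elt E) :
  opalg_val (a * b) = opalg_val a * opalg_val b.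
Proof. by []. Qed.

Lemma opalg_valZ (E : operatorAlgebra B) l (a : opalg_elt E) :
  opalg_val (l *: a) = l *: opalg_val a.
Proof. by []. Qed.

Lemma opalg_eltP (E : operatorAlgebra B) x : x \in E -> exists a : opalg_elt E, x = a.
Proof. by move=> xE; exists (OpalgElt xE). Qed.

Lemma dchar_extP Phi : {subset D <= A} -> is_dchar A D (dchar_ext Phi).
Proof.
move=> DA; split.
- by move=> _ /opalg_eltP[a ->]; rewrite dchar_extE; exact: opalg_valP.
- move=> _ _ /opalg_eltP[a ->] /opalg_eltP[b ->].
  by rewrite -opalg_valB !dchar_extE -opalg_valB raddfB.
- move=> _ _ /opalg_eltP[a ->] /opalg_eltP[b ->].
  by rewrite -opalg_valM !dchar_extE -opalg_valM rmorphM.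
- move=> l _ /opalg_eltP[a ->].
  by rewrite -opalg_valZ !dchar_extE -opalg_valZ linearZ.
- move=> x xD; have /opalg_eltP[a xa] := DA _ xD; rewrite xa dchar_extE.
  by rewrite xa in xD; rewrite (@dchar_id _ _ _ _ Phi a (OpalgElt xD)).
- by move=> _ /opalg_eltP[a ->]; rewrite dchar_extE dchar_contractive.
Qed.

(** The element 0 of [S] keeps the supremum from being [-oo]; once below [c] it is a real number,
    which serves as [k]. *)
Lemma opnorm_on_lt (S : set (opalg_elt A)) (f : opalg_elt A -> opalg_elt D) (c : R) :
  S 0 -> f 0 = 0 ->
  (opnorm_on S f < c%:E)%E <->
  exists2 k : R, k < c & forall a, S a -> nrm a <= 1 -> nrm (f a) <= k.
Proof.
move=> S0 f0; have ub a : S a -> nrm a <= 1 -> ((nrm (f a))%:E <= opnorm_on S f)%E.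
  by move=> Sa a1; apply: ereal_sup_ubound; exists a.
split=> [h|[k kc h]].
  have /(ub _ S0) : nrm (0 : opalg_elt A) <= 1 by rewrite nrm0.
  move: (opnorm_on S f) h ub => [x||]//=; rewrite lte_fin => xc ub _.
  by exists x => // a Sa a1; rewrite -lee_fin ub.
apply: (@le_lt_trans _ _ k%:E); last by rewrite lte_fin.
by apply: ge_ereal_sup => _ [a [Sa a1] <-]; rewrite lee_fin h.
Qed.

Lemma opnormB_lt2 Phi Psi : (opnorm_on setT (Phi \- Psi)%R < 2%:E)%E <->
  close A (dchar_ext Phi) (dchar_ext Psi).
Proof.
rewrite opnorm_on_lt//=; last first.
  by rewrite !raddf0 addr0.
split=> -[k k2 h]; exists k => //.
  by move=> _ /opalg_eltP[a ->] a1; rewrite !dchar_extE -opalg_valB h.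
by move=> a _ a1; have := h a (opalg_valP a) a1; rewrite !dchar_extE.
Qed.

Lemma opnorm_ker_lt1 Phi Psi : (opnorm_on (dchar_ker Psi) Phi < 1%:E)%E <->
  contracts_ker A (dchar_ext Phi) (dchar_ext Psi).
Proof.
rewrite opnorm_on_lt ?raddf0 /dchar_ker/= ?raddf0//.
split=> -[k k1 h]; exists k => //.
  move=> _ /opalg_eltP[a ->] a1; rewrite !dchar_extE => Pa.
  by apply: h => //; exact: val_inj.
by move=> a Pa a1; have := h a (opalg_valP a) a1; rewrite !dchar_extE Pa; apply.
Qed.

Lemma rho_bounded_ext Phi Psi : rho_bounded A (dchar_ext Phi) (dchar_ext Psi) <->
  exists2 M : R, 0 < M &
    forall a : opalg_elt A, nrm a < 1 -> rho (Phi a) (Psi a) <= M.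
Proof.
split=> -[M M0 h]; exists M => //.
  by move=> a a1; have := h a (opalg_valP a) a1; rewrite !dchar_extE.
by move=> _ /opalg_eltP[a ->] a1; rewrite !dchar_extE h.
Qed.

Definition norming Phi Psi := forall a : nat -> opalg_elt A,
  (forall n, nrm (a n) <= 1) ->
  nrm (Phi (a n)) @[n --> \oo] --> (1 : R) ->
  nrm (Psi (a n)) @[n --> \oo] --> (1 : R).

Hypothesis D_star : forall x : B, x \in D -> star x \in D.
Hypothesis DA : {subset D <= A}.

Lemma close_norming Phi Psi :
  close A (dchar_ext Phi) (dchar_ext Psi) -> norming Phi Psi.
Proof.
move=> c a a1 Phi1.
apply/cvgrPdist_lt => e e0.
(* [close_norm_gt] asks for [0 <= s], which [1 - e] violates when [e > 1]. *)
pose s := Num.max 0 (1 - e).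
have s0 : 0 <= s by rewrite le_max lexx.
have s1 : s < 1 by rewrite gt_max ltr01 gtrBl.
have [eta eta1 h] := close_norm_gt D_star DA (dchar_extP Phi DA) (dchar_extP Psi DA) c s0 s1.
near=> n.
have Psi1 : nrm (Psi (a n)) <= 1 by rewrite (le_trans (dchar_contractive _ _)).
have : s < nrm (Psi (a n)).
  have := h (a n) (opalg_valP _) (a1 n); rewrite !dchar_extE; apply.
  near: n; exact: cvgr_gt Phi1 _ eta1.
by rewrite gt_max => /andP[_ ?]; rewrite ger0_norm ?subr_ge0//; lra.
Unshelve. all: by end_near. Qed.

(** If no constant works, testing [1 - 1/(n+1)] for each [n] yields elements of the kernel of [Psi]
    in the unit ball with [nrm (Phi (a n))] tending to 1, while [nrm (Psi (a n))] is constantly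
    0. *)
Lemma norming_contracts_ker Phi Psi : norming Phi Psi ->
  contracts_ker A (dchar_ext Phi) (dchar_ext Psi).
Proof.
move=> nPP; apply: contrapT => nc.
have /choice[a aP] (n : nat) : exists a : opalg_elt A,
    [/\ nrm a <= 1, Psi a = 0 & 1 - n.+1%:R^-1 < nrm (Phi a)].
  apply: contrapT => na; apply: nc; exists (1 - n.+1%:R^-1).
    by rewrite gtrBl invr_gt0.
  move=> _ /opalg_eltP[a ->] a1; rewrite !dchar_extE => Pa.
  rewrite leNgt; apply/negP => Phia; apply: na; exists a; split => //.
  exact: val_inj.
have := nPP a (fun n => let: And3 h _ _ := aP n in h).
have Phi1 : nrm (Phi (a n)) @[n --> \oo] --> (1 : R).
  apply: (@squeeze_cvgr _ _ _ _ (fun n => 1 - n.+1%:R^-1) (fun=> 1)).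
  - near=> n; have [a1 _ /ltW->] := aP n.
    by rewrite (le_trans (dchar_contractive _ _)).
  - rewrite -[X in _ --> X]subr0; apply: cvgB; first exact: cvg_cst.
    exact: cvg_harmonic.
  - exact: cvg_cst.
move=> /(_ Phi1).
rewrite (_ : (fun n => nrm (Psi (a n))) = fun=> 0); last first.
  by apply/funext => n; have [_ -> _] := aP n; rewrite nrm0.
have z0 : (fun _ : nat => 0 : R) @ \oo --> (0 : R) by exact: cvg_cst.
by move=> /(cvg_unique (@Rhausdorff R) z0)/eqP; rewrite eq_sym oner_eq0.
Unshelve. all: by end_near. Qed.

End Bridge.

Theorem corollary5p4 (R : realType) (B : cstarAlgType R)
    (A D : operatorAlgebra B)
    (D_star : forall x : B, x \in D -> star x \in D)
    (D_sub_A : {subset D <= A}) :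
  (forall Phi Psi : dcharacter A D,
    [<-> (opnorm_on setT (Phi \- Psi)%R < 2%:E)%E;
         (opnorm_on (dchar_ker Psi) Phi < 1%:E)%E;
         exists2 M : R, 0 < M &
           forall a : opalg_elt A, nrm a < 1 -> rho (Phi a) (Psi a) <= M;
         forall a : nat -> opalg_elt A, (forall n, nrm (a n) <= 1) ->
           nrm (Phi (a n)) @[n --> \oo] --> (1 : R) ->
           nrm (Psi (a n)) @[n --> \oo] --> (1 : R)]) /\
  RelationClasses.Equivalence (fun Phi Psi : dcharacter A D =>
    (opnorm_on setT (Phi \- Psi)%R < 2%:E)%E).
Proof.
have dP (Phi : dcharacter A D) := dchar_extP Phi D_sub_A.
have kerE (Phi Psi : dcharacter A D) : close A (dchar_ext Phi) (dchar_ext Psi) <->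
    contracts_ker A (dchar_ext Phi) (dchar_ext Psi).
  split; first exact: (close_contracts_ker D_star D_sub_A (dP Phi) (dP Psi)).
  exact: (contracts_ker_close D_sub_A (dP Phi) (dP Psi)).
have sym (Phi Psi : dcharacter A D) : close A (dchar_ext Phi) (dchar_ext Psi) ->
  close A (dchar_ext Psi) (dchar_ext Phi) by exact: close_sym.
have normE (Phi Psi : dcharacter A D) :
    close A (dchar_ext Phi) (dchar_ext Psi) <-> norming Phi Psi.
  split; first exact: close_norming.
  by move=> /norming_contracts_ker; rewrite -kerE.
split=> [Phi Psi|].
  tfae.
  - by rewrite opnormB_lt2 opnorm_ker_lt1 kerE.
  (* The bound on [rho] needs [Psi] on the kernel of [Phi]; the symmetry of [close] exchanges the
     two. *)
  - rewrite opnorm_ker_lt1 -kerE => /sym; rewrite kerE -rho_bounded_ext.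
    exact: (contracts_ker_rho_bounded D_star D_sub_A).
  - rewrite -rho_bounded_ext => /(rho_bounded_contracts_ker (dP Phi) (dP Psi)).
    by rewrite -kerE => /sym; rewrite normE.
  - by rewrite opnormB_lt2 normE.
split.
- move=> Phi; rewrite opnormB_lt2; exists 0 => // x _ _.
  by rewrite subrr nrm0.
- by move=> Phi Psi; rewrite !opnormB_lt2; exact: sym.
(* Transitivity is immediate from the condition on sequences. *)
- move=> Phi Psi Theta; rewrite !opnormB_lt2 !normE => h1 h2 a a1 /(h1 a a1).
  exact: h2.
Qed.
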